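(* Let $m\in\mathbb{N}$, let $d\ge2$ be an integer, and let $\mathbb{T}$ be either $\mathbb{R}$ or $\mathbb{Z}$. Assume that, for each fixed $n\in\mathbb{N}_0$, $\{\mathbf{V}_n(t),\ t\in\mathbb{T}\}$ is an $m$-variate stationary stochastic process with $\mathrm{E}\,\mathbf{V}_n(t)=\mathbf{0}$ and $\mathrm{cov}(\mathbf{V}_n(t_1),\mathbf{V}_n(t_2))=\alpha_n^2\,\mathbf{B}_n(t_1-t_2)$, $t_1,t_2\in\mathbb{T}$, where $\alpha_n=\left(\frac{2n+d-1}{d-1}\right)^{1/2}$; that $\mathbf{U}$ is a $(d+1)$-dimensional random vector uniformly distributed on $\mathbb{S}^d$; and that $\mathbf{U}$ and $\{\mathbf{V}_n(t),t\in\mathbb{T}\}$, $n\in\mathbb{N}_0$, are independent. If $\sum_{n=0}^\infty\mathbf{B}_n(0)P_n^{\left(\frac{d-1}{2}\right)}(1)$ converges, then the $m$-variate random field $$\mathbf{Z}(\mathbf{x};t)=\sum_{n=0}^\infty\mathbf{V}_n(t)\,P_n^{\left(\frac{d-1}{2}\right)}(\mathbf{x}'\mathbf{U}),\qquad \mathbf{x}\in\mathbb{S}^d,\ t\in\mathbb{T},$$ is isotropic and mean square continuous on $\mathbb{S}^d$, stationary on $\mathbb{T}$, and possesses mean $\mathbf{0}$ and covariance matrix function $$\mathbf{C}(\vartheta;t)=\sum_{n=0}^\infty\mathbf{B}_n(t)\,P_n^{\left(\frac{d-1}{2}\right)}(\cos\vartheta),\qquad \vartheta\in[0,\pi],\ 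t\in\mathbb{T}.$$
   Context: $\mathbb{N}$ is the set of positive integers and $\mathbb{N}_0$ the set of nonnegative integers. $\mathbb{S}^d=\{\mathbf{x}\in\mathbb{R}^{d+1}:\|\mathbf{x}\|=1\}$ is the unit sphere, with spherical distance $\vartheta(\mathbf{x}_1,\mathbf{x}_2)=\arccos(\mathbf{x}_1'\mathbf{x}_2)\in[0,\pi]$. A prime denotes transpose. For $\lambda>0$, the ultraspherical (Gegenbauer) polynomials $P_n^{(\lambda)}$, $n\in\mathbb{N}_0$, are defined by $(1-2ux+u^2)^{-\lambda}=\sum_{n=0}^\infty u^nP_n^{(\lambda)}(x)$ for $|x|\le 1$, $|u|<1$. An $m$-variate random field is a family of $\mathbb{R}^m$-valued random vectors with finite second-order moments, and $\mathrm{cov}(\mathbf{X},\mathbf{Y})=\mathrm{E}\{(\mathbf{X}-\mathrm{E}\mathbf{X})(\mathbf{Y}-\mathrm{E}\mathbf{Y})'\}$. A random field on $\mathbb{S}^d\times\mathbb{T}$ is (wide-sense) isotropic on $\mathbb{S}^d$ and (wide-sense) stationary on $\mathbb{T}$ if its mean function is a constant vector and $\mathrm{cov}(\mathbf{Z}(\mathbf{x}_1;t_1),\mathbf{Z}(\mathbf{x}_2;t_2))$ depends only on $\vartheta(\mathbf{x}_1,\mathbf{x}_2)$ and $t_1-t_2$, in which case it is written $\mathbf{C}(\vartheta(\mathbf{x}_1,\mathbf{x}_2);t_1-t_2)$. It is mean square continuous on $\mathbb{S}^d$ if for each $t$ and each $\mathbf{x}_0\in\mathbb{S}^d$, $\mathrm{E}\|\mathbf{Z}(\mathbf{x};t)-\mathbf{Z}(\mathbf{x}_0;t)\|^2\to0$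 as $\mathbf{x}\to\mathbf{x}_0$. A stationary stochastic process is a wide-sense stationary one with finite second moments. The series defining $\mathbf{Z}(\mathbf{x};t)$ is understood in the mean square sense; convergence of series of matrices is entrywise. *)

(* Defs.v *)
From HB Require Import structures.
From mathcomp Require Import all_boot all_order all_algebra.
From mathcomp Require Import all_classical all_reals all_analysis.

Set Implicit Arguments.
Unset Strict Implicit.
Unset Printing Implicit Defensive.

Import Order.TTheory GRing.Theory Num.Theory.
Import numFieldNormedType.Exports.

Local Open Scope classical_set_scope.
Local Open Scope ring_scope.

(* The index group of time: R for [real_time], Z for [integer_time]. *)
Variant time_kind := real_time | integer_time.

Definition time_group (R : realType) (k : time_kind) : zmodType :=
  match k with
  | real_time => R
  | integer_time => int
  end.

Section Geometry.
Context {R : realType}.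

Definition dotv k (x y : 'cV[R]_k) : R := (x^T *m y) 0 0.

(* The library norm of a matrix is the sup norm, hence this Euclidean one. *)
Definition enorm k (x : 'cV[R]_k) : R := Num.sqrt (dotv x x).

Definition sphere (d : nat) : set 'cV[R]_d.+1 := [set x | enorm x = 1].

Definition sdist d (x y : 'cV[R]_d.+1) : R := acos (dotv x y).

Definition orthogonal_mx k (Q : 'M[R]_k) : Prop := Q^T *m Q = 1%:M.

Definition borel_cV k : set (set 'cV[R]_k) := <<s [set A | open A] >>.

End Geometry.

Arguments sphere {R} d _.

Section Gegenbauer.
Context {R : realType}.

(* The generating function determines [G n] on [-1, 1], hence as a
   polynomial. *)
Definition is_gegenbauer (lambda : R) (G : nat -> {poly R}) : Prop :=
  forall x u : R, `|x| <= 1 -> `|u| < 1 ->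
    series (fun n => u ^+ n * (G n).[x]) @ \oo -->
      (1 - 2 * u * x + u ^+ 2) `^ (- lambda).

Definition alpha (d n : nat) : R :=
  Num.sqrt ((2 * n%:R + d%:R - 1) / (d%:R - 1)).

(* Entrywise convergence of the series of matrices [\sum_n A n]. *)
Definition cvg_mxseries m (A : nat -> 'M[R]_m) : Prop :=
  forall i j, cvg (series (fun n => A n i j) @ \oo).

Definition mxseries_to m (A : nat -> 'M[R]_m) (S : 'M[R]_m) : Prop :=
  forall i j, series (fun n => A n i j) @ \oo --> S i j.

End Gegenbauer.

Section Random.
Context {R : realType} {disp : measure_display} {Omega : measurableType disp}.
Variable P : probability Omega R.

Definition entry m (X : Omega -> 'cV[R]_m) (i : 'I_m) : Omega -> R :=
  fun w => X w i 0.

Definition second_order m (X : Omega -> 'cV[R]_m) : Prop :=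
  forall i, entry X i \in Lfun P 2%:E.

Definition meanv m (X : Omega -> 'cV[R]_m) : 'cV[R]_m :=
  \col_i fine ('E_P[entry X i])%E.

Definition covmx m (X Y : Omega -> 'cV[R]_m) : 'M[R]_m :=
  \matrix_(i, j) fine (covariance P (entry X i) (entry Y j)).

Definition stationary (T : zmodType) m (V : T -> Omega -> 'cV[R]_m) : Prop :=
  [/\ forall t, second_order (V t),
      exists mu, forall t, meanv (V t) = mu &
      exists C : T -> 'M[R]_m, forall t1 t2, covmx (V t1) (V t2) = C (t1 - t2)].

(* The uniform law on the sphere is the rotation-invariant Borel probability
   measure carried by it. *)
Definition uniform_on_sphere d (U : Omega -> 'cV[R]_d.+1) : Prop :=
  [/\ forall i, measurable_fun setT (entry U i),
      P [set w | sphere d (U w)] = 1%E &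
      forall (Q : 'M[R]_d.+1) (A : set 'cV[R]_d.+1),
        orthogonal_mx Q -> borel_cV A ->
        P [set w | A (Q *m U w)] = P [set w | A (U w)]].

Definition sigma_of (T : Type) k (X : T -> Omega -> 'cV[R]_k) :
    set (set Omega) :=
  <<s [set S | exists t, preimage_set_system setT (X t) (@borel_cV R k) S] >>.

Definition mutually_independent (I : eqType) (F : I -> set (set Omega)) : Prop :=
  forall (s : seq I) (A : I -> set Omega),
    uniq s -> (forall i, i \in s -> F i (A i)) ->
    P (\big[setI/setT]_(i <- s) A i) = (\prod_(i <- s) P (A i))%E.

(* [U] and the whole processes [V 0], [V 1], ... form one independent family,
   [None] indexing [U]. *)
Definition independent_vector_processes (T : Type) k m (U : Omega -> 'cV[R]_k)
    (V : nat -> T -> Omega -> 'cV[R]_m) : Prop :=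
  mutually_independent (fun o : option nat =>
    if o is Some n then sigma_of (V n) else sigma_of (fun _ : unit => U)).

Definition mean_square_dist m (X Y : Omega -> 'cV[R]_m) : \bar R :=
  ('E_P[fun w => (enorm (X w - Y w) ^+ 2)%R])%E.

Definition mean_square_sum m (X : nat -> Omega -> 'cV[R]_m)
    (S : Omega -> 'cV[R]_m) : Prop :=
  second_order S /\
  mean_square_dist (fun w => \sum_(n < N) X n w) S @[N --> \oo] --> 0%E.

(* A random field on the sphere is a total function on ['cV[R]_d.+1] of which
   only the values on the sphere matter. *)
Definition has_covariance_function (T : zmodType) d m
    (Z : 'cV[R]_d.+1 -> T -> Omega -> 'cV[R]_m) (C : R -> T -> 'M[R]_m) : Prop :=
  forall x1 x2 t1 t2, sphere d x1 -> sphere d x2 ->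
    covmx (Z x1 t1) (Z x2 t2) = C (sdist x1 x2) (t1 - t2).

Definition isotropic_stationary (T : zmodType) d m
    (Z : 'cV[R]_d.+1 -> T -> Omega -> 'cV[R]_m) : Prop :=
  [/\ forall x t, sphere d x -> second_order (Z x t),
      exists mu, forall x t, sphere d x -> meanv (Z x t) = mu &
      exists C, has_covariance_function Z C].

Definition mean_square_continuous (T : Type) d m
    (Z : 'cV[R]_d.+1 -> T -> Omega -> 'cV[R]_m) : Prop :=
  forall t x0, sphere d x0 ->
    mean_square_dist (Z x t) (Z x0 t) @[x --> within (sphere d) (nbhs x0)]
      --> 0%E.

Definition is_series_field (T : Type) d m (G : nat -> {poly R})
    (U : Omega -> 'cV[R]_d.+1) (V : nat -> T -> Omega -> 'cV[R]_m)
    (Z : 'cV[R]_d.+1 -> T -> Omega -> 'cV[R]_m) : Prop :=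
  forall x t, sphere d x ->
    mean_square_sum (fun n w => (G n).[dotv x (U w)] *: V n t w) (Z x t).

End Random.

(* Main.v *)
Require Import Defs.
From HB Require Import structures.
From mathcomp Require Import all_boot all_order all_algebra.
From mathcomp Require Import all_classical all_reals all_analysis.
From mathcomp Require Import measurable_realfun ring lra.

Set Implicit Arguments.
Unset Strict Implicit.
Unset Printing Implicit Defensive.

Import Order.TTheory GRing.Theory Num.Theory.
Import numFieldNormedType.Exports.

Local Open Scope classical_set_scope.
Local Open Scope ring_scope.

(** Fix unit vectors [x], [y] and put [T = x'U], [W = y'U]. Reflections preserve
    the law of [U]; expanding the vanishing means
    [E ((v'U)^j z'U) = 0], [z] orthogonal to [v], yields for polynomials [g], [h]
      [c E (g'(T) h(W)) - E (T g'(T) W h(W)) + E (g(T) (1 - W^2) h'(W))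
        = d E (g(T) W h(W))],    [c = x'y],
    a Green formula on the sphere that only involves moments of [(T, W)].
    Together with the differential equation of the Gegenbauer polynomials [G_n]
    it gives [E (G_n(T) G_k(W)) = 0] for [n <> k], and then the numbers
    [(n + l) E (G_n(T) G_n(W))], [l = (d - 1) / 2], satisfy the three-term
    recurrence of [G_n(c)], so that [alpha_n^2 E (G_n(T) G_n(W)) = G_n(c)].
    By independence the terms of the series defining the field are then pairwise
    orthogonal in mean square, with inner products [G_n(x'y) B_n(t1 - t2)]:
    the series converges by completeness of [L^2], covariances are limits of
    covariances of partial sums, and mean square continuity follows from the
    uniform convergence of the covariance series at lag [0]. *)

(** * Gegenbauer polynomials *)

(** The law of [U] is given by invariance under orthogonal matrices, not by a density or a surface
    measure, so differentiation on the sphere has to be replaced. The substitute is algebraic: a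
    mean involving [((s x + y)'U)^j] is a polynomial in [s], and an identity valid for all [s] in
    [[-1, 1]] can be read off coefficient by coefficient. This is why many moment identities are
    stated for vectors of arbitrary length. The Gegenbauer part is carried out for an abstract
    bilinear form on polynomials that satisfies the Green formula in each argument. The weight
    [n + l] is the right normalisation because [alpha_n^2 = (n + l) / l] when [d = 2 l + 1]. The
    convergence hypothesis concerns lag 0 and argument 1 only. Its diagonal entries are second
    moments, hence nonnegative, which makes the partial sums Cauchy in mean square; convergence at
    all other arguments and lags is then inherited from the continuity of the inner product of
    [L^2]. *)

Section GegenbauerPolynomials.
Context {R : realType}.
Variables (l : R) (G : nat -> {poly R}).
Hypothesis l_gt0 : 0 < l.
Let L : {poly R} := l%:P.
Hypothesis G0 : G 0 = 1.
Hypothesis G1 : G 1 = 2 * L * 'X.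
Hypothesis Grec : forall n, n.+2%:R * G n.+2 =
  2 * (n.+1%:R + L) * 'X * G n.+1 - (n%:R + 2 * L) * G n.

Let derivL : L^`() = 0. Proof. exact: derivC. Qed.
Let deriv_natr n : (n%:R : {poly R})^`() = 0.
Proof. by rewrite -polyC_natr derivC. Qed.

Let derivE' := (poly.derivE, derivL, deriv_natr).
Let polyCE := (@polyCD R, @polyCN R, @polyCM R, @polyC_natr R, @polyC1 R).

Let natr_poly_neq0 n : (n.+1%:R : {poly R}) != 0.
Proof. by rewrite -polyC_natr polyC_eq0 pnatr_eq0. Qed.

Lemma gegenbauer_deriv n :
  'X * (G n.+1)^`() - (G n)^`() = n.+1%:R * G n.+1 /\
  (G n.+1)^`() - 'X * (G n)^`() = (n%:R + 2 * L) * G n.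
Proof.
elim: n => [|n [IHA IHB]].
  rewrite G0 G1 !derivE'; split; ring.
have EB : (G n.+2)^`() - 'X * (G n.+1)^`() = (n.+1%:R + 2 * L) * G n.+1.
  apply: (mulfI (natr_poly_neq0 n.+1)).
  have /(congr1 (@deriv R)) := Grec n.
  rewrite !derivE' => E.
  transitivity (n.+2%:R * (G n.+2)^`() - n.+2%:R * 'X * (G n.+1)^`()); first ring.
  transitivity (2 * (n.+1%:R + L) * (G n.+1 + 'X * (G n.+1)^`())
    - (n%:R + 2 * L) * (G n)^`() - n.+2%:R * 'X * (G n.+1)^`()).
    congr (_ - _); transitivity (0 * G n.+2 + n.+2%:R * (G n.+2)^`()); first ring.
    rewrite E; ring.
  have -> : (G n)^`() = 'X * (G n.+1)^`() - n.+1%:R * G n.+1 by rewrite -IHA; ring.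
  ring.
split=> //.
have -> : (G n.+2)^`() = 'X * (G n.+1)^`() + (n.+1%:R + 2 * L) * G n.+1.
  by rewrite -EB; ring.
rewrite Grec.
have E1 : 'X * (G n.+1)^`() = (G n)^`() + n.+1%:R * G n.+1 by rewrite -IHA; ring.
have E2 : (G n.+1)^`() = 'X * (G n)^`() + (n%:R + 2 * L) * G n by rewrite -IHB; ring.
rewrite mulrDr E1 [X in _ - X]E2; ring.
Qed.

Lemma gegenbauer_derivXl n :
  'X * (G n.+1)^`() = n.+1%:R * G n.+1 + (G n)^`().
Proof. by rewrite -(gegenbauer_deriv n).1; ring. Qed.

(** Iterated, this writes a derivative as a combination of Gegenbauer polynomials of lower index, to
    which orthogonality applies. *)
Lemma gegenbauer_derivSS n :
  (G n.+2)^`() = 2 * (n.+1%:R + L) * G n.+1 + (G n)^`().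
Proof.
have [_ E] := gegenbauer_deriv n.+1.
have -> : (G n.+2)^`() = (n.+1%:R + 2 * L) * G n.+1 + 'X * (G n.+1)^`().
  by rewrite -E; ring.
rewrite gegenbauer_derivXl; ring.
Qed.

Lemma gegenbauer_deriv1X2 n : (1 - 'X ^+ 2) * (G n.+1)^`() =
  (n%:R + 2 * L) * G n - n.+1%:R * 'X * G n.+1.
Proof.
have [_ E] := gegenbauer_deriv n.
transitivity ((G n.+1)^`() - 'X * ('X * (G n.+1)^`())); first ring.
rewrite gegenbauer_derivXl.
have -> : (G n.+1)^`() = (n%:R + 2 * L) * G n + 'X * (G n)^`() by rewrite -E; ring.
ring.
Qed.

(** Derivative of [gegenbauer_deriv1X2], simplified by [gegenbauer_derivXl]. For [l > 0] the
    eigenvalues [- n (n + 2 l)] are pairwise distinct. *)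
Lemma gegenbauer_ode n :
  (1 - 'X ^+ 2) * (G n)^`()^`() - (2 * L + 1) * ('X * (G n)^`()) =
  - (n%:R * (n%:R + 2 * L)) * G n.
Proof.
case: n => [|n]; first by rewrite G0 !derivE'; ring.
have /(congr1 (@deriv R)) := gegenbauer_deriv1X2 n.
rewrite !derivE' => E.
transitivity ((0 - ('X + 'X)) * (G n.+1)^`() + (1 - 'X ^+ 2) * (G n.+1)^`()^`()
   - (2 * L - 1) * ('X * (G n.+1)^`())); first ring.
transitivity (((n%:R + 2 * L) * (G n)^`() - n.+1%:R * (G n.+1 + 'X * (G n.+1)^`()))
   - (2 * L - 1) * ('X * (G n.+1)^`())).
  congr (_ - _); transitivity (- ('X *+ 2) * (G n.+1)^`() + (1 - 'X ^+ 2) * (G n.+1)^`()^`()).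
    ring.
  move: E; set a := (G n.+1)^`(); set b := (G n)^`(); set e := a^`() => E.
  transitivity ((0 - 'X *+ 2) * a + (1 - 'X ^+ 2) * e); first ring.
  rewrite E; ring.
rewrite gegenbauer_derivXl; ring.
Qed.

(** [Lam p q] will be the mean of [p(x'U) q(y'U)] and [c] the inner product [x'y]. Symmetry of [Lam]
    is not assumed, so the Green formula is required in both orders. *)
Variables (Lam : {poly R} -> {poly R} -> R) (c : R).
Hypothesis LamDl : forall p q r, Lam (p + q) r = Lam p r + Lam q r.
Hypothesis LamDr : forall p q r, Lam p (q + r) = Lam p q + Lam p r.
Hypothesis LamZl : forall a p q, Lam (a%:P * p) q = a * Lam p q.
Hypothesis LamZr : forall a p q, Lam p (a%:P * q) = a * Lam p q.
Hypothesis Lam11 : Lam 1 1 = 1.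
Hypothesis Greenr : forall g h,
  c * Lam g^`() h - Lam ('X * g^`()) ('X * h) + Lam g ((1 - 'X ^+ 2) * h^`()) =
  (2 * l + 1) * Lam g ('X * h).
Hypothesis Greenl : forall g h,
  c * Lam h g^`() - Lam ('X * h) ('X * g^`()) + Lam ((1 - 'X ^+ 2) * h^`()) g =
  (2 * l + 1) * Lam ('X * h) g.

(** The Green formulas, taken with a derivative as undifferentiated argument, say that the operator
    of [gegenbauer_ode] is symmetric for [Lam]; eigenvectors for distinct eigenvalues are then
    orthogonal. *)
Lemma gegenbauer_orthogonal n k : n != k -> Lam (G n) (G k) = 0.
Proof.
move=> nk.
have cst i : - (i%:R * (i%:R + 2 * L)) = (- (i%:R * (i%:R + 2 * l)))%:P :> {poly R}.
  by rewrite !polyCE /L.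
have LamBl p q r : Lam (p - q) r = Lam p r - Lam q r.
  have -> : - q = (-1)%:P * q by rewrite !polyCE; ring.
  by rewrite LamDl LamZl mulN1r.
have LamBr p q r : Lam p (q - r) = Lam p q - Lam p r.
  have -> : - r = (-1)%:P * r by rewrite !polyCE; ring.
  by rewrite LamDr LamZr mulN1r.
have cst1 : 2 * L + 1 = (2 * l + 1)%:P by rewrite !polyCE.
have E1 := Greenr (G n) (G k)^`().
have E2 := Greenl (G k) (G n)^`().
have F1 : Lam (G n) (- (k%:R * (k%:R + 2 * L)) * G k) =
          Lam (- (n%:R * (n%:R + 2 * L)) * G n) (G k).
  rewrite -!gegenbauer_ode LamBl LamBr cst1 LamZl LamZr -E1 -E2; ring.
move: F1; rewrite !cst LamZl LamZr => F1.
have F2 : (n%:R - k%:R) * (n%:R + k%:R + 2 * l) * Lam (G n) (G k) = 0.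
  transitivity (- (- (n%:R * (n%:R + 2 * l)) * Lam (G n) (G k))
    + - (k%:R * (k%:R + 2 * l)) * Lam (G n) (G k)); first ring.
  rewrite F1; ring.
move/eqP: F2; rewrite !mulf_eq0 -orbA => /or3P[||/eqP//].
  by rewrite subr_eq0 eqr_nat (negbTE nk).
by rewrite gt_eqF// ltr_wpDl ?mulr_gt0// addr_ge0.
Qed.

(** By [gegenbauer_derivSS] the derivative only involves indices below [k]; the step of length two
    explains the paired induction. *)
Lemma gegenbauer_deriv_orthogonal k n : (k <= n)%N -> Lam (G k)^`() (G n) = 0.
Proof.
have LamZl' a p q : Lam ((2 * (a%:R + L)) * p) q = 2 * (a%:R + l) * Lam p q.
  by rewrite -LamZl !polyCE.
have Lam0 q : Lam 0 q = 0 by have := LamZl 0 0 q; rewrite mulr0 mul0r.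
suff [] : ((k <= n)%N -> Lam (G k)^`() (G n) = 0) /\
   ((k.+1 <= n)%N -> Lam (G k.+1)^`() (G n) = 0) by [].
elim: k => [|k [IH1 IH2]]; split=> //.
- by move=> _; rewrite G0 poly.derivE Lam0.
- move=> n0; have -> : (G 1)^`() = (2 * l)%:P * G 0.
    by rewrite G1 G0 !derivE' !polyCE; ring.
  by rewrite LamZl gegenbauer_orthogonal ?mulr0// ltn_eqF.
- move=> kn; rewrite gegenbauer_derivSS LamDl LamZl' gegenbauer_orthogonal ?ltn_eqF//.
  by rewrite mulr0 add0r IH1// ltnW// ltnW.
Qed.

(** The Green formula for [G k.+2] and [G k.+1] collapses, by orthogonality, to a linear relation
    between the three diagonal values [Lam (G i) (G i)], [i = k, k + 1, k + 2]. After weighting by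
    [i + l] it is the recurrence of the [G i] at [c]. *)
Lemma gegenbauer_reproducing n : (n%:R + l) * Lam (G n) (G n) = l * (G n).[c].
Proof.
have LamBr p q r : Lam p (q - r) = Lam p q - Lam p r.
  have -> : - r = (-1)%:P * r by rewrite !polyCE; ring.
  by rewrite LamDr LamZr mulN1r.
have Lam0l q : Lam 0 q = 0 by have := LamZl 0 0 q; rewrite mulr0 mul0r.
have Lam0r q : Lam q 0 = 0 by have := LamZr 0 q 0; rewrite mulr0 mul0r.
have e2L : 2 * L = (2 * l)%:P by rewrite !polyCE.
suff [] : (n%:R + l) * Lam (G n) (G n) = l * (G n).[c] /\
  (n.+1%:R + l) * Lam (G n.+1) (G n.+1) = l * (G n.+1).[c] by [].
elim: n => [|k [IH1 IH2]]; split=> //.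
- by rewrite G0 Lam11 !hornerE.
- rewrite G1 e2L LamZl LamZr hornerM hornerC hornerX.
  have := Greenr 'X 1; rewrite !derivE' mulr1 mulr0 Lam11 Lam0r => E.
  have {}E : Lam 'X 'X * (2 * l + 2) = c.
    move: E; rewrite !mulr1; lra.
  rewrite -E; ring.
have cst1 : 2 * (k.+1%:R + L) = (2 * (k.+1%:R + l))%:P by rewrite !polyCE.
have cst2 : k%:R + 2 * L = (k%:R + 2 * l)%:P by rewrite !polyCE.
have cstn i : i%:R = (i%:R)%:P :> {poly R} by rewrite polyC_natr.
set e : R := 2 * (k.+1%:R + l).
(* Multiplication by ['X] is expanded through the recurrence; the factor [e] avoids denominators and
   is carried through to the final identity. *)
have EX : e%:P * ('X * G k.+1) = k.+2%:R%:P * G k.+2 + (k%:R + 2 * l)%:P * G k.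
  by rewrite -cst1 -cst2 -cstn Grec; ring.
have orth i j := @gegenbauer_orthogonal i j.
have T1 : Lam (G k.+2)^`() (G k.+1) = e * Lam (G k.+1) (G k.+1).
  by rewrite gegenbauer_derivSS LamDl cst1 LamZl gegenbauer_deriv_orthogonal ?addr0.
have T2 : Lam (G k.+1)^`() (G k) = 2 * (k%:R + l) * Lam (G k) (G k).
  case: (k) => [|j].
    have -> : (G 1)^`() = (2 * l)%:P * G 0.
      by rewrite G1 G0 e2L !poly.derivE; ring.
    by rewrite LamZl add0r.
  rewrite gegenbauer_derivSS LamDl gegenbauer_deriv_orthogonal ?addr0//.
  by rewrite -LamZl !polyCE.
have T3 : e * Lam ('X * (G k.+2)^`()) ('X * G k.+1) =
   k.+2%:R ^+ 2 * Lam (G k.+2) (G k.+2) +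
   (k%:R + 2 * l) * (2 * (k%:R + l) * Lam (G k) (G k)).
  rewrite -LamZr EX gegenbauer_derivXl LamDl !LamDr cstn !LamZl !LamZr -T2.
  rewrite (orth k.+2 k) ?gtn_eqF// gegenbauer_deriv_orthogonal//; ring.
have T4 : e * Lam (G k.+2) ('X * G k.+1) = k.+2%:R * Lam (G k.+2) (G k.+2).
  by rewrite -LamZr EX LamDr !LamZr (orth k.+2 k) ?gtn_eqF// mulr0 addr0.
have T5 : Lam (G k.+2) ((1 - 'X ^+ 2) * (G k.+1)^`()) =
    - k.+1%:R * Lam (G k.+2) ('X * G k.+1).
  rewrite gegenbauer_deriv1X2 LamBr cst2 LamZr (orth k.+2 k) ?gtn_eqF//.
  by rewrite -mulrA cstn LamZr; ring.
have := congr1 ( *%R e) (Greenr (G k.+2) (G k.+1)).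
have EG : k.+2%:R * (G k.+2).[c] =
    e * c * (G k.+1).[c] - (k%:R + 2 * l) * (G k).[c].
  have /(congr1 (fun p => p.[c])) := Grec k.
  by rewrite cst1 cst2 -/e cstn hornerD hornerN !(hornerM, hornerC, hornerX).
rewrite T1 T5; move: T3 T4 IH1 IH2 EG.
set b := Lam ('X * _) _; set a := Lam _ ('X * _).
set K2 := Lam (G k.+2) _; set K1 := Lam (G k.+1) _; set K0 := Lam (G k) _.
set g2 := (G k.+2).[c]; set g1 := (G k.+1).[c]; set g0 := (G k).[c].
move=> T3 T4 IH1 IH2 E E'.
have k2 : k.+2%:R != 0 :> R by rewrite pnatr_eq0.
apply: (mulfI k2).
have -> : k.+2%:R * (l * g2) = l * (k.+2%:R * g2) by ring.
rewrite E mulrBr.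
have -> : l * (e * c * g1) = e * c * (l * g1) by ring.
have -> : l * ((k%:R + 2 * l) * g0) = (k%:R + 2 * l) * (l * g0) by ring.
rewrite -IH1 -IH2.
have {}E' : e * (c * (e * K1)) - (e * b) - k.+1%:R * (e * a) = (2 * l + 1) * (e * a).
  transitivity (e * (c * (e * K1) - b + - k.+1%:R * a)); first ring.
  rewrite E'; ring.
move: E'; rewrite T3 T4 /e -!natr1.
set x := k%:R.
move=> E'; lra.
Qed.

End GegenbauerPolynomials.

(** * The generating function *)

Section PowerSeries.
Context {R : realType}.
Implicit Types (a b : nat -> R) (z s : R).

Lemma norm_lt1_interpolate z : `|z| < 1 -> exists2 K : R, `|K| < 1 & `|z| < `|K|.
Proof.
move=> z1; have z0 := normr_ge0 z.
have e : `|(1 + `|z|) / 2| = (1 + `|z|) / 2 by rewrite ger0_norm//; lra.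
by exists ((1 + `|z|) / 2); rewrite e; lra.
Qed.

Lemma norm_lt1_near z : `|z| < 1 -> \forall y \near z, `|y| < 1.
Proof.
move=> z1; apply/nbhs_ballP; exists (1 - `|z|); first by rewrite /= subr_gt0.
move=> y; rewrite -ball_normE/= => zy.
have -> : y = z - (z - y) by ring.
by rewrite (le_lt_trans (ler_normB _ _))// -ltrBrDl.
Qed.

(** Between [|z|] and 1 there is room for radii [r < q < p]: convergence at [p] gives absolute
    convergence at [q], and the factor [n + 1] of the differentiated series is absorbed by the
    geometric gap between [r] and [q]. *)
Lemma is_cvg_pseries_diffs a :
  (forall z, `|z| < 1 -> cvgn (pseries a z)) ->
  forall z, `|z| < 1 -> cvgn (pseries (pseries_diffs a) z).
Proof.
move=> ca z z1.
pose r := (1 + `|z|) / 2; pose q := (1 + r) / 2.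
have zr : `|z| < r by rewrite /r; lra.
have r1 : r < 1 by rewrite /r; lra.
have r0 : 0 < r by rewrite (le_lt_trans _ zr).
have rq : r < q by rewrite /q; lra.
have q1 : q < 1 by rewrite /q; lra.
have q0 : 0 < q by rewrite (lt_trans r0).
pose p := (q + 1) / 2.
have qp : q < p by rewrite /p; lra.
have p1 : p < 1 by rewrite /p; lra.
clearbody p q r.
have := ca p; rewrite gtr0_norm ?(lt_trans q0)// => /(_ p1) cp.
have cq : cvgn (pseries (fun i => `|a i|) q).
  by apply: is_cvg_pseries_inside_norm cp _; rewrite !gtr0_norm// (lt_trans q0).
apply: normed_cvg.
(* Chosen so that [(n + 1) r^n <= C q^(n + 1)]. *)
pose C := (q / r - 1)^-1 / r.
have C0 : 0 < q / r - 1 by rewrite subr_gt0 ltr_pdivlMr ?mul1r.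
(* Bernoulli: [(n + 1) (q / r - 1) <= (q / r) ^ (n + 1)] *)
have Bern n : n%:R * (q / r - 1) <= (q / r) ^+ n.
  elim: n => [|n IH]; first by rewrite mul0r expr0.
  rewrite exprS -natr1 mulrDl mul1r.
  have x1 : 1 <= (q / r) ^+ n by rewrite exprn_ege1// ler_pdivlMr// mul1r ltW.
  have -> : q / r * (q / r) ^+ n = (q / r) ^+ n + (q / r - 1) * (q / r) ^+ n by ring.
  by rewrite lerD// ler_peMr// ltW.
apply: (@series_le_cvg _ _ (fun n => C * (`|a n.+1| * q ^+ n.+1))) => [n|n|n|].
- exact: normr_ge0.
- rewrite /C !mulr_ge0// ?invr_ge0 ?exprn_ge0// ltW//.
- rewrite /= /pseries_diffs !normrM normrX [`|_.+1%:R|]ger0_norm//.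
  have -> : C * (`|a n.+1| * q ^+ n.+1) =
      (`|a n.+1| * r ^+ n) * ((q / r - 1)^-1 * (q / r) ^+ n.+1).
    rewrite /C expr_div_n [r ^+ n.+1]exprS.
    field; rewrite expf_neq0 ?gt_eqF//=; lra.
  have -> : n.+1%:R * `|a n.+1| * `|z| ^+ n = (`|a n.+1| * `|z| ^+ n) * n.+1%:R by ring.
  apply: ler_pM => //.
    by rewrite ler_wpM2l// lerXn2r ?nnegrE// ltW.
  by rewrite mulrC ler_pdivlMr.
have -> : series (fun n => C * (`|a n.+1| * q ^+ n.+1)) =
    C *: series (fun n => `|a n.+1| * q ^+ n.+1) by rewrite -seriesZ.
apply: is_cvgZr => //.
have := cq; rewrite /pseries => /cvg_ex[l cl].
apply/cvg_ex; exists (l - `|a 0|).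
have -> : series (fun n => `|a n.+1| * q ^+ n.+1) =
    (fun n => pseries (fun i => `|a i|) q n.+1 - `|a 0|).
  apply/funext => n; rewrite /pseries /series/= big_nat_recl//= expr0 mulr1; ring.
apply: cvgB; last exact: cvg_cst.
by rewrite cvg_shiftS.
Qed.

(** The value at 0 is the constant coefficient; the termwise derivative again sums to 0 and moves
    every coefficient down by one, hence the induction on [n] for all sequences [a]. *)
Lemma pseries_eq0 a : (forall z, `|z| < 1 -> pseries a z @ \oo --> (0 : R)) ->
  forall n, a n = 0.
Proof.
move=> a0 n; elim: n a a0 => [|n IH] a a0.
  have := a0 0; rewrite normr0 ltr01 => /(_ isT) c0.
  have c1 : pseries a 0 @ \oo --> a 0.
    rewrite -cvg_shiftS; apply: cvg_near_cst; near=> k.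
    rewrite /pseries /series/= big_nat_recl//= expr0 mulr1 big1 ?addr0// => i _.
    by rewrite expr0n mulr0.
  by rewrite -(cvg_lim (@Rhausdorff _) c0) -(cvg_lim (@Rhausdorff _) c1).
have ca z : `|z| < 1 -> cvgn (pseries a z) by move=> /a0/cvgP.
have cd := is_cvg_pseries_diffs ca.
have cdd := is_cvg_pseries_diffs cd.
have : n.+1%:R * a n.+1 = 0.
  apply: (IH (pseries_diffs a)) => z z1.
  have [K K1 zK] := norm_lt1_interpolate z1.
  have D := pseries_snd_diffs (ca _ K1) (cd _ K1) (cdd _ K1) zK.
  have D0 : is_derive z (1 : R) (fun z => limn (pseries a z)) 0.
    apply: (@near_eq_is_derive _ _ _ (cst 0)).
    by apply: filterS (norm_lt1_near z1) => y /a0/(cvg_lim (@Rhausdorff _)) ->.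
  have <- : limn (pseries (pseries_diffs a) z) = 0.
    by rewrite -[LHS](@derive_val _ _ _ _ _ _ _ D) (@derive_val _ _ _ _ _ _ _ D0).
  exact: cd.
by move/eqP; rewrite mulf_eq0 pnatr_eq0/= => /eqP.
Unshelve. all: by end_near. Qed.

Definition pseries_shift a n : R := if n is k.+1 then a k else 0.

Lemma pseries_shift_cvg a z s : pseries a z @ \oo --> s ->
  pseries (pseries_shift a) z @ \oo --> z * s.
Proof.
move=> cs; rewrite -cvg_shiftS.
have -> : [sequence pseries (pseries_shift a) z n.+1]_n = z *: pseries a z.
  apply/funext => n; rewrite /pseries /series/= big_nat_recl//= mul0r add0r.
  rewrite -[RHS]/(z * \sum_(0 <= i < n) a i * z ^+ i) mulr_sumr.
  by apply: eq_bigr => i _; rewrite exprS; ring.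
exact: cvgMl_tmp.
Qed.

Lemma pseriesD_cvg a b z s t : pseries a z @ \oo --> s -> pseries b z @ \oo --> t ->
  pseries (fun n => a n + b n) z @ \oo --> s + t.
Proof.
move=> ca cb; have -> : pseries (fun n => a n + b n) z = pseries a z + pseries b z.
  by rewrite /pseries -seriesD; congr series; apply/funext => n /=; rewrite mulrDl.
exact: cvgD.
Qed.

Lemma pseriesZ_cvg a k z s : pseries a z @ \oo --> s ->
  pseries (fun n => k * a n) z @ \oo --> k * s.
Proof.
move=> ca; have -> : pseries (fun n => k * a n) z = k *: pseries a z.
  by rewrite /pseries -seriesZ; congr series; apply/funext => n /=; rewrite -mulrA.
exact: cvgMl_tmp.
Qed.

End PowerSeries.

(** * From the generating function to the three-term recurrence *)

Section GeneratingFunction.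
Context {R : realType}.
Variables (l : R) (G : nat -> {poly R}).
Hypothesis GG : is_gegenbauer l G.

(** The generating function [F] solves [(1 - 2 u x + u^2) F'(u) = 2 l (x - u) F(u)], an equation
    free of real powers, whose coefficients in [u] give the recurrence. [F'] is computed termwise
    and by the chain rule; the latter needs the positivity of the base, which is at least
    [(1 - |u|)^2]. *)
Lemma gegenbauer_horner x : `|x| <= 1 ->
  [/\ (G 0).[x] = 1, (G 1).[x] = 2 * l * x &
   forall n, n.+2%:R * (G n.+2).[x] =
     2 * (n.+1%:R + l) * x * (G n.+1).[x] - (n%:R + 2 * l) * (G n).[x]].
Proof.
move=> x1; pose p n := (G n).[x].
have Fp u : `|u| < 1 -> pseries p u @ \oo --> (1 - 2 * u * x + u ^+ 2) `^ (- l).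
  move=> u1; have -> : pseries p u = series (fun n => u ^+ n * (G n).[x]).
    by rewrite /pseries; congr series; apply/funext => n; rewrite mulrC.
  exact: GG.
have ca z : `|z| < 1 -> cvgn (pseries p z) by move=> /Fp/cvgP.
have cd := is_cvg_pseries_diffs ca.
have cdd := is_cvg_pseries_diffs cd.
have pos u : `|u| < 1 -> 0 < 1 - 2 * u * x + u ^+ 2.
  move=> u1; have : 0 < (1 - `|u|) ^+ 2 by rewrite exprn_gt0// subr_gt0.
  rewrite sqrrB expr1n mul1r real_normK ?num_real// => h; apply: lt_le_trans h _.
  rewrite lerD2r lerD2l lerN2 -mulrA mulr_natl lerMn2r/=.
  by rewrite (le_trans (ler_norm _))// normrM ler_piMr.
have Dp u : `|u| < 1 -> limn (pseries (pseries_diffs p) u) =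
   (- l * (1 - 2 * u * x + u ^+ 2) `^ (- l - 1)) * (2 * u - 2 * x).
  move=> u1; have [K K1 uK] := norm_lt1_interpolate u1.
  have D := pseries_snd_diffs (ca _ K1) (cd _ K1) (cdd _ K1) uK.
  rewrite -[LHS](@derive_val _ _ _ _ _ _ _ D).
  pose w (y : R) := 1 - 2 * y * x + y ^+ 2.
  have Dw : is_derive u 1 w (2 * u - 2 * x).
    by apply: is_derive_eq; rewrite /GRing.scale/=; ring.
  have Dc : is_derive u 1 ((fun y => y `^ (- l)) \o w)
      ((- l * (w u) `^ (- l - 1)) * (2 * u - 2 * x)).
    have := @is_derive1_powR R (- l) (w u) (pos u u1) => Dpow.
    exact: is_derive1_comp.
  apply: derive_val; apply: near_eq_is_derive Dc.
  by apply: filterS (norm_lt1_near u1) => y /Fp/(cvg_lim (@Rhausdorff _)) ->.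
(* the coefficients of [(1 - 2 u x + u^2) F'(u) - 2 l (x - u) F(u)] *)
pose D := pseries_diffs p.
pose b n := (D n + (- 2 * x) * pseries_shift D n + pseries_shift (pseries_shift D) n)
  + ((- 2 * l * x) * p n + (2 * l) * pseries_shift p n).
have b0 n : b n = 0.
  apply: pseries_eq0 => z z1; have cz := Fp _ z1.
  have cDz : pseries D z @ \oo --> limn (pseries D z) := cd _ z1.
  have sD := pseries_shift_cvg cDz.
  have c := pseriesD_cvg (pseriesD_cvg (pseriesD_cvg cDz (pseriesZ_cvg (k := - 2 * x) sD))
    (pseries_shift_cvg sD)) (pseriesD_cvg (pseriesZ_cvg (k := - 2 * l * x) cz)
    (pseriesZ_cvg (k := 2 * l) (pseries_shift_cvg cz))).
  have -> : 0 = limn (pseries D z) + (- 2 * x) * (z * limn (pseries D z)) +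
     z * (z * limn (pseries D z)) +
     ((- 2 * l * x) * (1 - 2 * z * x + z ^+ 2) `^ (- l) +
      (2 * l) * (z * (1 - 2 * z * x + z ^+ 2) `^ (- l))).
    rewrite Dp//; set w := 1 - 2 * z * x + z ^+ 2.
    have -> : w `^ (- l) = w * w `^ (- l - 1).
      have w0 : 0 < w := pos z z1.
      rewrite -[X in X * _]powRr1 ?ltW// -powRD ?(gt_eqF w0) ?implybT//.
      by congr (_ `^ _); ring.
    by rewrite /w; ring.
  exact: c.
have p0 : p 0 = 1.
  have := Fp 0; rewrite normr0 ltr01 => /(_ isT).
  rewrite mulr0 mul0r subr0 expr0n addr0 powR1 => c0.
  have c1 : pseries p 0 @ \oo --> p 0.
    rewrite -cvg_shiftS; apply: cvg_near_cst; near=> k.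
    rewrite /pseries /series/= big_nat_recl//= expr0 mulr1 big1 ?addr0// => i _.
    by rewrite expr0n mulr0.
  by rewrite -(cvg_lim (@Rhausdorff _) c0) -(cvg_lim (@Rhausdorff _) c1).
have p1 : p 1 = 2 * l * x.
  have := b0 0; rewrite /b /D /pseries_diffs /pseries_shift/= p0; lra.
split=> // -[|n].
  have := b0 1; rewrite /b /D /pseries_diffs /pseries_shift/= => e.
  by apply/eqP; rewrite -subr_eq0 -e; apply/eqP; rewrite /p; ring.
have := b0 n.+2; rewrite /b /D /pseries_diffs /pseries_shift/= => e.
by apply/eqP; rewrite -subr_eq0 -e; apply/eqP; rewrite /p; ring.
Unshelve. all: by end_near. Qed.

(** The points [1 / (i + 1)], [i < size p], are already too many roots. *)
Lemma poly_unit_itv_eq0 (p : {poly R}) : (forall x, `|x| <= 1 -> p.[x] = 0) -> p = 0.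
Proof.
move=> p0; apply: (@roots_geq_poly_eq0 _ _ [seq i.+1%:R^-1 | i <- iota 0 (size p)]).
- apply/allP => _ /mapP[i _ ->]; apply/eqP/p0.
  by rewrite ger0_norm ?invr_ge0// invf_le1 ?ler1n.
- rewrite map_inj_in_uniq ?iota_uniq// => i j _ _ /invr_inj/eqP.
  by rewrite eqr_nat eqSS => /eqP.
- by rewrite size_map size_iota.
Qed.

Lemma gegenbauer_rec : [/\ G 0 = 1, G 1 = 2 * l%:P * 'X &
  forall n, n.+2%:R * G n.+2 =
    2 * (n.+1%:R + l%:P) * 'X * G n.+1 - (n%:R + 2 * l%:P) * G n].
Proof.
have cstn i : i%:R = (i%:R)%:P :> {poly R} by rewrite polyC_natr.
split=> [||n]; apply/eqP; rewrite -subr_eq0; apply/eqP; apply: poly_unit_itv_eq0 => x x1;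
  have [e0 e1 e2] := gegenbauer_horner x1; rewrite hornerD hornerN.
- by rewrite hornerC e0 subrr.
- by rewrite !cstn !(hornerM, hornerC, hornerX) e1 subrr.
- rewrite hornerD hornerN !cstn !(hornerD, hornerM, hornerC, hornerX) e2; ring.
Qed.

End GeneratingFunction.

(** * The Euclidean inner product *)

Section DotProduct.
Context {R : realType} {k : nat}.
Implicit Types (x y u : 'cV[R]_k).

Lemma dotvE x y : dotv x y = \sum_i x i 0 * y i 0.
Proof. by rewrite /dotv mxE; apply: eq_bigr => i _; rewrite mxE. Qed.

Lemma dotvC x y : dotv x y = dotv y x.
Proof. by rewrite !dotvE; apply: eq_bigr => i _; rewrite mulrC. Qed.

Lemma dotvDl x y u : dotv (x + y) u = dotv x u + dotv y u.
Proof. by rewrite !dotvE -big_split; apply: eq_bigr => i _; rewrite mxE mulrDl. Qed.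

Lemma dotvZl a x u : dotv (a *: x) u = a * dotv x u.
Proof. by rewrite !dotvE mulr_sumr; apply: eq_bigr => i _; rewrite mxE mulrA. Qed.

Lemma dotvNl x u : dotv (- x) u = - dotv x u.
Proof. by rewrite -scaleN1r dotvZl mulN1r. Qed.

Lemma dotvBl x y u : dotv (x - y) u = dotv x u - dotv y u.
Proof. by rewrite dotvDl dotvNl. Qed.

Lemma dotvDr x y u : dotv u (x + y) = dotv u x + dotv u y.
Proof. by rewrite dotvC dotvDl !(dotvC u). Qed.

Lemma dotvZr a x u : dotv u (a *: x) = a * dotv u x.
Proof. by rewrite dotvC dotvZl dotvC. Qed.

Lemma dotvBr x y u : dotv u (x - y) = dotv u x - dotv u y.
Proof. by rewrite dotvC dotvBl !(dotvC u). Qed.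

Lemma dotv_mulmxr (Q : 'M[R]_k) x u : dotv x (Q *m u) = dotv (Q^T *m x) u.
Proof. by rewrite /dotv trmx_mul trmxK mulmxA. Qed.

Lemma dotvv_ge0 x : 0 <= dotv x x.
Proof. by rewrite dotvE sumr_ge0// => i _; rewrite -expr2 sqr_ge0. Qed.

Lemma dotvv_eq0 x : (dotv x x == 0) = (x == 0).
Proof.
apply/eqP/eqP => [|->]; last first.
  by rewrite dotvE big1// => i _; rewrite mxE mul0r.
rewrite dotvE => /psumr_eq0P x0; apply/matrixP => i j; rewrite !ord1 mxE.
by apply/eqP; rewrite -[_ == _]sqrf_eq0 expr2 x0// => l _; rewrite -expr2 sqr_ge0.
Qed.

Lemma dotv_delta i u : dotv (delta_mx i 0) u = u i 0.
Proof.
rewrite dotvE (bigD1 i)//= big1 ?addr0 => [|j ji].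
  by rewrite mxE !eqxx mul1r.
by rewrite mxE (negbTE ji) mul0r.
Qed.

Lemma dotv_cauchy_schwarz x y : dotv x y ^+ 2 <= dotv x x * dotv y y.
Proof.
have [->|y0] := eqVneq y 0.
  have z0 : dotv (0 : 'cV[R]_k) 0 = 0 by apply/eqP; rewrite dotvv_eq0.
  rewrite z0 mulr0; have -> : dotv x 0 = 0.
    by rewrite dotvE big1// => i _; rewrite mxE mulr0.
  by rewrite expr2 mulr0.
have yy : 0 < dotv y y by rewrite lt_def dotvv_eq0 y0 dotvv_ge0.
have := dotvv_ge0 (dotv y y *: x - dotv x y *: y).
rewrite !(dotvBl, dotvBr, dotvZl, dotvZr) (dotvC y x) => H.
suff : 0 <= dotv y y * (dotv x x * dotv y y - dotv x y ^+ 2).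
  by rewrite pmulr_rge0// subr_ge0.
apply: le_trans H _; rewrite le_eqVlt; apply/orP; left; apply/eqP; ring.
Qed.

Lemma continuous_dotv x : continuous (dotv x).
Proof.
have -> : dotv x = \sum_i (fun u : 'cV[R]_k => x i 0 * u i 0).
  by apply/funext => u; rewrite dotvE fct_sumE.
move=> u; apply: (@big_ind _ (fun f : 'cV[R]_k -> R => {for u, continuous f})).
- exact: (@cst_continuous _ _ (0 : R)).
- by move=> f g; exact: continuousD.
- move=> i _; apply: (@continuous_comp _ _ _ (fun v : 'cV[R]_k => v i 0)
    (fun t : R => x i 0 * t)); first exact: coord_continuous.
  exact: mulrl_continuous.
Qed.

Lemma continuous_dotv_horner x y (p q : {poly R}) :
  continuous (fun u => p.[dotv x u] * q.[dotv y u]).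
Proof.
have cp (z : 'cV[R]_k) (r : {poly R}) : continuous (fun u => r.[dotv z u]).
  move=> u; apply: (@continuous_comp _ _ _ (dotv z) (horner r)).
    exact: continuous_dotv.
  exact: continuous_horner.
by move=> u; apply: (@continuousM _ _ _ _ u); exact: cp.
Qed.

Lemma borel_cV_preimage (phi : 'cV[R]_k -> R) (A : set R) : continuous phi ->
  measurable A -> borel_cV (phi @^-1` A).
Proof.
move=> /continuousP cphi mA.
pose T := g_sigma_algebraType [set A : set 'cV[R]_k | open A].
suff : measurable_fun (setT : set T) (phi : T -> R).
  by move=> /(_ measurableT _ mA); rewrite setTI.
apply: (measurability _ (RGenOpens.measurableE R)).
move=> _ [_ [a [b ->] <-]]; rewrite setTI; apply: sub_sigma_algebra.
by apply: cphi; exact: interval_open.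
Qed.

End DotProduct.

(** * Real expectations and independence *)

Section RealExpectation.
Context {R : realType} {disp : measure_display} {Omega : measurableType disp}.
Variable P : probability Omega R.
Implicit Types (X Y Z : Omega -> R).

(** A non-finite expectation becomes 0, so the rules of calculation below carry integrability
    hypotheses. *)
Definition mean X : R := fine 'E_P[X]%E.

Lemma meanK X : X \in Lfun P 1 -> ((mean X)%:E = 'E_P[X])%E.
Proof. by move=> X1; rewrite /mean fineK// expectation_fin_num. Qed.

Lemma Lfun_measurable p X : X \in Lfun P p -> measurable_fun setT X.
Proof. by rewrite inE => /andP[]; rewrite inE. Qed.

Lemma meanE X Y : X =1 Y -> mean X = mean Y.
Proof. by move=> /funext ->. Qed.

Lemma mean_cst c : mean (fun=> c) = c.
Proof. by rewrite /mean (expectation_cst P c). Qed.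

Lemma meanD X Y : X \in Lfun P 1 -> Y \in Lfun P 1 ->
  mean (fun w => X w + Y w) = mean X + mean Y.
Proof.
move=> X1 Y1; rewrite /mean -[fun w => _]/(X \+ Y) expectationD// fineD//;
  exact: expectation_fin_num.
Qed.

Lemma meanZ c X : X \in Lfun P 1 -> mean (fun w => c * X w) = c * mean X.
Proof.
move=> X1; rewrite /mean; have -> : (fun w => c * X w) = c \o* X.
  by apply/funext => w /=; rewrite mulrC.
by rewrite expectationZl// fineM// expectation_fin_num.
Qed.

Lemma LfunZ c X r : 1 <= r -> X \in Lfun P r%:E -> (fun w => c * X w) \in Lfun P r%:E.
Proof.
move=> r1 X1; have -> : (fun w => c * X w) = c \o* X.
  by apply/funext => w /=; rewrite mulrC.
exact: Lfun_scale.
Qed.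

Lemma LfunD X Y r : 1 <= r -> X \in Lfun P r%:E -> Y \in Lfun P r%:E ->
  (fun w => X w + Y w) \in Lfun P r%:E.
Proof. by move=> r1 X1 Y1; rewrite -[fun w => _]/(X \+ Y) rpredD. Qed.

Lemma Lfun_lsum r n (F : 'I_n -> Omega -> R) : 1 <= r ->
  (forall i, F i \in Lfun P r%:E) -> (fun w => \sum_(i < n) F i w) \in Lfun P r%:E.
Proof.
move=> r1; elim: n F => [|n IH] F Fi.
  have -> : (fun w => \sum_(i < 0) F i w) = cst 0 by apply/funext => w; rewrite big_ord0.
  exact: Lfun_cst.
have -> : (fun w => \sum_(i < n.+1) F i w) =
    (fun w => (fun w => \sum_(i < n) F (widen_ord (leqnSn n) i) w) w + F ord_max w).
  by apply/funext => w; rewrite big_ord_recr.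
by apply: LfunD => //; apply: IH.
Qed.

Lemma mean_lsum n (F : 'I_n -> Omega -> R) : (forall i, F i \in Lfun P 1) ->
  mean (fun w => \sum_(i < n) F i w) = \sum_(i < n) mean (F i).
Proof.
elim: n F => [|n IH] F Fi.
  rewrite big_ord0 -[RHS]mean_cst; apply: meanE => w; exact: big_ord0.
rewrite big_ord_recr/= -IH// -meanD//; last by apply: Lfun_lsum.
by apply: meanE => w; rewrite big_ord_recr.
Qed.

Lemma Lfun2_Lfun1 X : X \in Lfun P 2%:E -> X \in Lfun P 1.
Proof. by apply: Lfun_subset12; exact: fin_num_measure. Qed.

Lemma Lfun2M X Y : X \in Lfun P 2%:E -> Y \in Lfun P 2%:E ->
  (fun w => X w * Y w) \in Lfun P 1.
Proof. exact: Lfun2_mul_Lfun1. Qed.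

Lemma Lfun2P X : X \in Lfun P 2%:E <->
  measurable_fun setT X /\ (fun w => X w ^+ 2) \in Lfun P 1.
Proof.
split=> [X2|[mX X2]].
  split; first exact: Lfun_measurable X2.
  by under eq_fun do rewrite expr2; exact: Lfun2M.
rewrite inE; apply/andP; split; rewrite inE//= /finite_norm unlock/=.
rewrite poweR_lty//; under eq_integral => w _.
  rewrite -[2]/2%:R powR_mulrn// real_normK ?num_real//; over.
move: X2 => /Lfun1_integrable/integrableP[_]; apply: le_lt_trans.
apply: ge0_le_integral => //.
- by move=> w _; rewrite lee_fin sqr_ge0.
- by apply/measurable_EFinP; exact: measurable_funX.
- by apply: measurableT_comp => //; apply/measurable_EFinP; exact: measurable_funX.
- by move=> w _ /=; rewrite lee_fin ler_norm.
Qed.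

Lemma mean_ge0 X : (forall w, 0 <= X w) -> 0 <= mean X.
Proof. by move=> X0; rewrite fine_ge0// expectation_ge0. Qed.

Lemma covarianceEmean X Y : X \in Lfun P 2%:E -> Y \in Lfun P 2%:E ->
  fine (covariance P X Y) = mean (fun w => X w * Y w) - mean X * mean Y.
Proof.
move=> X2 Y2; have X1 := Lfun2_Lfun1 X2; have Y1 := Lfun2_Lfun1 Y2.
have XY := Lfun2M X2 Y2.
rewrite covarianceE// -!meanK// -[(X * Y)%R]/(fun w => X w * Y w).
Qed.

Definition independent_rv X Y := forall A B, measurable A -> measurable B ->
  P (X @^-1` A `&` Y @^-1` B) = (P (X @^-1` A) * P (Y @^-1` B))%E.

Lemma preimage_measurable X A : measurable_fun setT X -> measurable A ->
  measurable (X @^-1` A).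
Proof. by move=> mX mA; rewrite -[X in measurable X]setTI; exact: mX. Qed.

(** The joint law is the product of the marginal laws; Tonelli gives integrability of the product
    and Fubini the factorisation. Integrability of the factors has to suffice, since one of them
    will be a product of two square integrable entries of [V]. *)
Lemma independent_rv_mean X Y : independent_rv X Y ->
  X \in Lfun P 1 -> Y \in Lfun P 1 ->
  (fun w => X w * Y w) \in Lfun P 1 /\ mean (fun w => X w * Y w) = mean X * mean Y.
Proof.
move=> iXY X1 Y1.
have mX := Lfun_measurable X1; have mY := Lfun_measurable Y1.
pose rX : {mfun Omega >-> R} := HB.pack X (isMeasurableFun.Build _ _ _ _ _ mX).
pose rY : {mfun Omega >-> R} := HB.pack Y (isMeasurableFun.Build _ _ _ _ _ mY).
have mXY : measurable_fun setT (fun w => (X w, Y w)).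
  exact: measurable_fun_pair.
pose rXY : {mfun Omega >-> (R * R)%type} :=
  HB.pack (fun w => (X w, Y w)) (isMeasurableFun.Build _ _ _ _ _ mXY).
(* Independence is agreement on rectangles, and these determine the product measure. *)
have prodE (A : set (R * R)) : measurable A ->
    (distribution P rX \x distribution P rY)%E A = distribution P rXY A.
  by apply: product_measure_unique => S T mS mT; rewrite -iXY.
pose f (z : R * R) : \bar R := (z.1 * z.2)%:E.
have mf : measurable_fun setT f.
  by apply/measurable_EFinP; apply: measurable_funM.
have iX : (distribution P rX).-integrable setT EFin.
  apply: (@integrable_pushforward _ _ _ _ _ _ mX P) => //.
  by rewrite preimage_setT; exact/Lfun1_integrable.
have iY : (distribution P rY).-integrable setT EFin.
  apply: (@integrable_pushforward _ _ _ _ _ _ mY P) => //.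
  by rewrite preimage_setT; exact/Lfun1_integrable.
have XE : (\int[distribution P rX]_x x%:E = (mean X)%:E)%E.
  by rewrite meanK// unlock; apply: integral_distribution => //; exact/Lfun1_integrable.
have YE : (\int[distribution P rY]_x x%:E = (mean Y)%:E)%E.
  by rewrite meanK// unlock; apply: integral_distribution => //; exact/Lfun1_integrable.
have iprod : (distribution P rX \x distribution P rY)%E.-integrable setT f.
  apply/integrable12ltyP => //.
  have aY : (\int[distribution P rY]_y `|y%:E| < +oo)%E by case/integrableP: iY.
  have aX : (\int[distribution P rX]_y `|y%:E| < +oo)%E by case/integrableP: iX.
  have fY : (\int[distribution P rY]_y `|y%:E|)%E \is a fin_num.
    by rewrite ge0_fin_numE// integral_ge0.
  have mabs : measurable_fun setT (fun x : R => `|x|%:E).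
    by apply/measurable_EFinP; exact: normr_measurable.
  have Ex x : (\int[distribution P rY]_y `|f (x, y)| =
      `|x|%:E * \int[distribution P rY]_y `|y%:E|)%E.
    rewrite -ge0_integralZl//; apply: eq_integral => y _.
    by rewrite /f/= normrM EFinM.
  under eq_integral do rewrite Ex.
  rewrite -(fineK fY) /= ge0_integralZr//.
  - by rewrite lte_mul_pinfty// ?integral_ge0// ?ltey// ge0_fin_numE// integral_ge0.
  - by rewrite lee_fin fine_ge0// integral_ge0.
have iXYd : (distribution P rXY).-integrable setT f.
  move/integrableP : (iprod) => [_ lt]; apply/integrableP; split => //.
  rewrite (eq_measure_integral (distribution P rX \x distribution P rY)%E)// => A mA _.
  exact/esym/prodE.
have iXY1 : P.-integrable setT (f \o rXY).
  move/integrableP: (iXYd) => [_ lt]; apply/integrableP; split.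
    exact: measurableT_comp.
  rewrite -(@ge0_integral_distribution _ _ _ _ _ P rXY (abse \o f))//=.
    have maf : measurable_fun setT (abse \o f) by exact: measurableT_comp.
    exact maf.
have XY1 : (fun w => X w * Y w) \in Lfun P 1 by apply/Lfun1_integrable.
split=> //; apply: EFin_inj; rewrite meanK// unlock.
rewrite -[LHS]/(\int[P]_w (f \o rXY) w)%E -integral_distribution//.
rewrite (eq_measure_integral (distribution P rX \x distribution P rY)%E)//; last first.
  by move=> A mA _; exact/esym/prodE.
rewrite -integral12_prod_meas1// /fubini_F /f/=.
under eq_integral => x _.
  under eq_integral => y _ do rewrite EFinM.
  rewrite integralZl// YE; over.
by rewrite integralZr// XE.
Qed.

(** For fixed [A], restrict [P] to the event [X^-1(A)] and push it forward by [(Y, Z)]. On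
    rectangles the result is [P(X^-1(A))] times the product of the laws of [Y] and [Z], hence so it
    is on all measurable sets; taking [A] full identifies the law of [(Y, Z)]. *)
Lemma independent_rv3 X Y Z : measurable_fun setT X -> measurable_fun setT Y ->
  measurable_fun setT Z ->
  (forall A B C, measurable A -> measurable B -> measurable C ->
    P (X @^-1` A `&` (Y @^-1` B `&` Z @^-1` C)) =
    (P (X @^-1` A) * (P (Y @^-1` B) * P (Z @^-1` C)))%E) ->
  independent_rv X (fun w => Y w * Z w).
Proof.
move=> mX mY mZ ind.
pose rY : {mfun Omega >-> R} := HB.pack Y (isMeasurableFun.Build _ _ _ _ _ mY).
pose rZ : {mfun Omega >-> R} := HB.pack Z (isMeasurableFun.Build _ _ _ _ _ mZ).
have mYZ : measurable_fun setT (fun w => (Y w, Z w)) by exact: measurable_fun_pair.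
have key A : measurable A -> forall S : set (R * R), measurable S ->
    P (X @^-1` A `&` (fun w => (Y w, Z w)) @^-1` S) =
    (P (X @^-1` A) * (distribution P rY \x distribution P rZ) S)%E.
  move=> mA S mS; have mXA := preimage_measurable mX mA.
  have p0 : 0 <= fine (P (X @^-1` A)) by rewrite fine_ge0.
  pose p := NngNum p0.
  have pE : P (X @^-1` A) = p%:num%:E by rewrite fineK// fin_num_measure.
  (* With the scalar moved into the first factor, uniqueness of product measures applies to both
     sides of the claim. *)
  have <- : (mscale p (distribution P rY) \x distribution P rZ)%E S =
      (P (X @^-1` A) * (distribution P rY \x distribution P rZ) S)%E.
    rewrite pE; apply: (@product_measure_unique _ _ _ _ _ _ _
      (mscale p (distribution P rY \x distribution P rZ)%E)) => // B C mB mC.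
    have e := product_measure1E (distribution P rY) (distribution P rZ) mB mC.
    by rewrite /mscale/= -muleA -e.
  have -> : P (X @^-1` A `&` (fun w => (Y w, Z w)) @^-1` S) =
      pushforward (mrestr P mXA) (fun w => (Y w, Z w)) S.
    by rewrite /pushforward /mrestr setIC.
  apply/esym; apply: (@product_measure_unique _ _ _ _ _ _ _
      (pushforward (mrestr P mXA) (fun w => (Y w, Z w)))) => // B C mB mC.
  transitivity (P (X @^-1` A `&` (Y @^-1` B `&` Z @^-1` C))).
    by rewrite /pushforward /mrestr setIC.
  by rewrite ind// pE muleA.
move=> A B mA mB.
pose S : set (R * R) := [set z | B (z.1 * z.2)].
have mS : measurable S.
  by rewrite -[S]setTI; apply: (measurable_funM measurable_fst measurable_snd).
have e : (fun w => Y w * Z w) @^-1` B = (fun w => (Y w, Z w)) @^-1` S by [].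
have := key setT measurableT S mS; rewrite preimage_setT setTI probability_setT mul1e.
by rewrite e key// => ->.
Qed.

End RealExpectation.

(** * Mean square convergence *)

Section MeanSquareLimits.
Context {R : realType} {disp : measure_display} {Omega : measurableType disp}.
Variable P : probability Omega R.
Implicit Types (X Y Z T : Omega -> R) (S : nat -> Omega -> R).

Local Notation mean := (mean P).
Local Notation L2 := (Lfun P 2%:E).

Lemma Lfun2Z c X : X \in L2 -> (fun w => c * X w) \in L2.
Proof. by apply: LfunZ; rewrite ler1n. Qed.

Lemma Lfun2D X Y : X \in L2 -> Y \in L2 -> (fun w => X w + Y w) \in L2.
Proof. by apply: LfunD; rewrite ler1n. Qed.

Lemma Lfun2B X Y : X \in L2 -> Y \in L2 -> (fun w => X w - Y w) \in L2.
Proof.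
move=> X2 Y2; have -> : (fun w => X w - Y w) = (fun w => X w + (fun w => -1 * Y w) w).
  by apply/funext => w; rewrite mulN1r.
by apply: Lfun2D => //; exact: Lfun2Z.
Qed.

Lemma Lfun2_sqr X : X \in L2 -> (fun w => X w ^+ 2) \in Lfun P 1.
Proof. by case/Lfun2P. Qed.

Lemma meanB X Y : X \in Lfun P 1 -> Y \in Lfun P 1 ->
  mean (fun w => X w - Y w) = mean X - mean Y.
Proof.
move=> X1 Y1; rewrite -mulN1r -meanZ// -meanD//; last exact: LfunZ.
by apply: meanE => w; rewrite mulN1r.
Qed.

Lemma mean_sqrB X Y : X \in L2 -> Y \in L2 -> mean (fun w => (X w - Y w) ^+ 2) =
  mean (fun w => X w ^+ 2) - 2 * mean (fun w => X w * Y w) + mean (fun w => Y w ^+ 2).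
Proof.
move=> X2 Y2; have XY := Lfun2M X2 Y2.
rewrite -meanZ// -meanB ?LfunZ ?Lfun2_sqr// -meanD ?Lfun2_sqr//; last first.
  have -> : (fun w => X w ^+ 2 - 2 * (X w * Y w)) =
     (fun w => X w ^+ 2 + (- 2) * (X w * Y w)) by apply/funext => w; ring.
  by apply: LfunD => //; [exact: Lfun2_sqr | exact: LfunZ].
by apply: meanE => w; ring.
Qed.

Lemma mean_cauchy_schwarz X Y : X \in L2 -> Y \in L2 ->
  `|mean (fun w => X w * Y w)| <=
  Num.sqrt (mean (fun w => X w ^+ 2)) * Num.sqrt (mean (fun w => Y w ^+ 2)).
Proof.
move=> X2 Y2; set c := mean _; set a := mean _; set b := mean _.
have a0 : 0 <= a by apply: mean_ge0 => w; exact: sqr_ge0.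
have b0 : 0 <= b by apply: mean_ge0 => w; exact: sqr_ge0.
have q t : 0 <= a - 2 * (t * c) + t ^+ 2 * b.
  have := mean_sqrB X2 (Lfun2Z t Y2).
  have -> : mean (fun w => X w * (t * Y w)) = t * c.
    by rewrite -meanZ ?Lfun2M//; apply: meanE => w; ring.
  have -> : mean (fun w => (t * Y w) ^+ 2) = t ^+ 2 * b.
    by rewrite -meanZ ?Lfun2_sqr//; apply: meanE => w; ring.
  by move=> <-; apply: mean_ge0 => w; exact: sqr_ge0.
suff cab : c ^+ 2 <= a * b.
  by rewrite -sqrtrM// -sqrtr_sqr ler_wsqrtr.
have [b00|bn0] := eqVneq b 0; last first.
  have bp : 0 < b by rewrite lt_def bn0.
  have := q (c / b); have -> : a - 2 * (c / b * c) + (c / b) ^+ 2 * b = (a * b - c ^+ 2) / b.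
    by field.
  by rewrite pmulr_lge0 ?invr_gt0// subr_ge0.
rewrite b00 mulr0; have [->|c0] := eqVneq c 0; first by rewrite expr0n.
(* When [b = 0] the quadratic is affine in [t], and this [t] would give it the value [-1]. *)
have := q ((a + 1) / (2 * c)); rewrite b00 mulr0 addr0.
have -> : 2 * ((a + 1) / (2 * c) * c) = a + 1 by field.
lra.
Qed.

(** Because of the default value of [mean], this has its usual meaning only for differences in
    [L^2]. *)
Definition ms_cvg S T := mean (fun w => (S n w - T w) ^+ 2) @[n --> \oo] --> 0.

(** Cauchy-Schwarz on each term of [SS' - TT' = (S - T)(S' - T') + T(S' - T') + (S - T)T']. *)
Lemma ms_cvg_inner S S' T T' : (forall n, S n \in L2) -> (forall n, S' n \in L2) ->
  T \in L2 -> T' \in L2 -> ms_cvg S T -> ms_cvg S' T' ->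
  mean (fun w => S n w * S' n w) @[n --> \oo] --> mean (fun w => T w * T' w).
Proof.
move=> S2 S'2 T2 T'2 cS cS'; apply/subr_cvg0/norm_cvg0P.
pose r n := Num.sqrt (mean (fun w => (S n w - T w) ^+ 2)).
pose r' n := Num.sqrt (mean (fun w => (S' n w - T' w) ^+ 2)).
pose u := Num.sqrt (mean (fun w => T w ^+ 2)).
pose u' := Num.sqrt (mean (fun w => T' w ^+ 2)).
have cr : r n @[n --> \oo] --> 0.
  by rewrite -[X in _ --> X]sqrtr0; apply: (continuous_cvg _ _ cS); exact: sqrt_continuous.
have cr' : r' n @[n --> \oo] --> 0.
  by rewrite -[X in _ --> X]sqrtr0; apply: (continuous_cvg _ _ cS'); exact: sqrt_continuous.
have cb : r n * r' n + u * r' n + r n * u' @[n --> \oo] --> 0.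
  have -> : 0 = 0 * 0 + u * 0 + 0 * u' by ring.
  by apply: cvgD; [apply: cvgD; [exact: cvgM|exact: cvgMl_tmp]|exact: cvgMr_tmp].
apply: (@squeeze_cvgr _ _ _ _ (cst 0) _ _ _ _ (cvg_cst _) cb).
near=> n; rewrite normr_ge0/=.
have D2 : (fun w => S n w - T w) \in L2 by exact: Lfun2B.
have D'2 : (fun w => S' n w - T' w) \in L2 by exact: Lfun2B.
have -> : mean (fun w => S n w * S' n w) - mean (fun w => T w * T' w) =
   mean (fun w => (S n w - T w) * (S' n w - T' w)) +
   mean (fun w => T w * (S' n w - T' w)) + mean (fun w => (S n w - T w) * T' w).
  rewrite -!meanD ?Lfun2M//; last exact: LfunD (Lfun2M _ _) (Lfun2M _ _).
  by rewrite -meanB ?Lfun2M//; apply: meanE => w; ring.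
rewrite (le_trans (ler_normD _ _))// lerD//.
  by rewrite (le_trans (ler_normD _ _))// lerD//; exact: mean_cauchy_schwarz.
exact: mean_cauchy_schwarz.
Unshelve. all: by end_near. Qed.

Lemma ms_cvg_mean S T : (forall n, S n \in L2) -> T \in L2 -> ms_cvg S T ->
  mean (S n) @[n --> \oo] --> mean T.
Proof.
move=> S2 T2 cS; have c1 : ms_cvg (fun=> cst 1) (cst 1).
  rewrite /ms_cvg [X in X @ _ --> _](_ : _ = cst 0); last first.
    apply/funext => n; rewrite -[RHS](mean_cst P); apply: meanE => w.
    by rewrite subrr expr0n.
  exact: cvg_cst.
have := ms_cvg_inner S2 (fun=> Lfun_cst P 1 2) T2 (Lfun_cst P 1 2) cS c1.
have e X : mean (fun w => X w * cst 1 w) = mean X by apply: meanE => w; rewrite mulr1.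
by rewrite e; under eq_fun do rewrite e.
Qed.

End MeanSquareLimits.

(** * Completeness of [L^2] *)

Section MeanSquareCompleteness.
Context {R : realType} {disp : measure_display} {Omega : measurableType disp}.
Variable P : probability Omega R.
Implicit Types (X Y Z T : Omega -> R) (S : nat -> Omega -> R).

Local Notation mean := (mean P).
Local Notation L2 := (Lfun P 2%:E).

Definition ms_cauchy S := forall e, 0 < e -> exists N, forall n m,
  (N <= n)%N -> (N <= m)%N -> mean (fun w => (S n w - S m w) ^+ 2) <= e.

(* From [E(D_k^2) <= 4^-k] one gets [\sum_k 2^k D_k^2 < oo] almost surely, and
   [2 |D_k| <= 2^-k + 2^k D_k^2] makes [\sum_k D_k] converge absolutely. *)
Lemma ae_cvg_of_fast S : (forall n, S n \in L2) ->
  (forall k, mean (fun w => (S k.+1 w - S k w) ^+ 2) <= (2^-1 ^+ k) ^+ 2) ->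
  {ae P, forall w, cvgn (fun k => S k w)}.
Proof.
move=> S2 fast.
pose D k w := S k.+1 w - S k w.
have D2 k : D k \in L2 by exact: Lfun2B.
pose h k w : \bar R := (2 ^+ k * D k w ^+ 2)%:E.
have h1 k : (fun w => 2 ^+ k * D k w ^+ 2) \in Lfun P 1.
  by apply: LfunZ => //; exact: Lfun2_sqr.
have mh k : measurable_fun setT (h k).
  by apply/measurable_EFinP; exact: Lfun_measurable (h1 k).
have h0 k w : (0 <= h k w)%E by rewrite lee_fin mulr_ge0 ?sqr_ge0// exprn_ge0.
pose H w := (\sum_(k <oo) h k w)%E.
have H0 w : (0 <= H w)%E by exact: nneseries_ge0.
have mH : measurable_fun setT H by exact: ge0_emeasurable_sum.
have iH : P.-integrable setT H.
  apply/integrableP; split => //.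
  under eq_integral do rewrite gee0_abs//.
  rewrite integral_nneseries//.
  have le k : (\int[P]_w h k w <= ((2 ^ k)%:R^-1)%:E)%E.
    have -> : (\int[P]_w h k w = (2 ^+ k * mean (fun w => D k w ^+ 2))%:E)%E.
      by rewrite -meanZ ?Lfun2_sqr// meanK// unlock.
    rewrite lee_fin natrX.
    apply: (le_trans (ler_wpM2l _ (fast k))); first by rewrite exprn_ge0.
    by rewrite expr2 mulrA -exprMn divff// expr1n mul1r exprVn.
  apply: (@le_lt_trans _ _ (\sum_(k <oo) ((2 ^ k)%:R^-1)%:E)%E).
    by apply: lee_nneseries => [k _ _|k _]; [exact: integral_ge0|exact: le].
  have := @cvg_geometric_eseries_half R 2 0.
  under [X in eseries X]eq_fun => k.
    rewrite addn1 expnS natrM invfM mulrA divff// mul1r; over.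
  by move=> /(cvg_lim (@ereal_hausdorff R)); rewrite /eseries/= => ->; rewrite ltey.
have : {ae P, forall w, setT w -> H w \is a fin_num} by exact: integrable_ae.
apply: filterS => w /(_ Logic.I) Hw.
have cD : cvgn (series (fun k => D k w)).
  apply: normed_cvg.
  apply: (@series_le_cvg _ _ (fun k => 2^-1 ^+ k + 2 ^+ k * D k w ^+ 2)) => [k|k|k|].
  - exact: normr_ge0.
  - by apply: addr_ge0; [rewrite exprn_ge0|rewrite mulr_ge0 ?sqr_ge0// exprn_ge0].
  - have := sqr_ge0 (2^-1 ^+ k - `|D k w|).
    have p0 : 0 < 2 ^+ k :> R by rewrite exprn_gt0.
    have pE : 2^-1 ^+ k = (2 ^+ k)^-1 :> R by rewrite exprVn.
    rewrite -[D k w ^+ 2]real_normK ?num_real//= pE; move: p0.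
    set p : R := 2 ^+ k; set a := `|D k w| => p0 sq.
    have a0 : 0 <= a by exact: normr_ge0.
    have : 0 <= p * (p^-1 - a) ^+ 2 by rewrite mulr_ge0// ltW.
    have -> : p * (p^-1 - a) ^+ 2 = p^-1 - 2 * a + p * a ^+ 2.
      by field; rewrite gt_eqF.
    lra.
  - have -> : (fun k => 2^-1 ^+ k + 2 ^+ k * D k w ^+ 2) =
      geometric 1 (2^-1) + (fun k => 2 ^+ k * D k w ^+ 2).
      by apply/funext => k; rewrite -[RHS]/(1 * 2^-1 ^+ k + 2 ^+ k * D k w ^+ 2) mul1r.
    apply: is_cvg_seriesD.
      by apply: is_cvg_geometric_series; rewrite gtr0_norm ?invr_gt0// invf_lt1// ltr1n.
    apply: nondecreasing_is_cvgn.
      apply: nondecreasing_series => k _ _.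
      by rewrite mulr_ge0 ?sqr_ge0// exprn_ge0.
    exists (fine (H w)) => _ [n _ <-].
    rewrite -lee_fin fineK// /series/= -sumEFin.
    by apply: (@nneseries_lim_ge _ (h ^~ w) xpredT 0%N n) => k _ _; exact: h0.
have -> : (fun k => S k w) = (fun k => series (fun k => D k w) k + S 0%N w).
  by apply/funext => k; rewrite /series/= telescope_sumr// subrK.
by apply: is_cvgD => //; exact: is_cvg_cst.
Qed.

(** The Riesz-Fischer argument: a fast subsequence converges almost surely, and Fatou's lemma along
    it turns the Cauchy bounds into bounds on the distance to the limit. *)
Lemma ms_complete S : (forall n, S n \in L2) -> ms_cauchy S ->
  exists2 T, T \in L2 & ms_cvg P S T.
Proof.
move=> S2 cS.
have e0 k : 0 < (2^-1 ^+ k) ^+ 2 :> R by rewrite !exprn_gt0// invr_gt0.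
pose f k := projT1 (cid (cS _ (e0 k))).
have fP k n m : (f k <= n)%N -> (f k <= m)%N ->
    mean (fun w => (S n w - S m w) ^+ 2) <= (2^-1 ^+ k) ^+ 2.
  by rewrite /f; case: cid => N0 /= H; exact: H.
(* The sum makes the indices nondecreasing, at least [f k], and at least [k]. *)
pose N k := (\sum_(j < k.+1) (f j).+1)%N.
have fN k : (f k <= N k)%N by rewrite /N big_ord_recr/= addnS leqW// leq_addl.
have NS k : (N k <= N k.+1)%N by rewrite /N [in leqRHS]big_ord_recr/= leq_addr.
have kN k : (k <= N k)%N.
  by elim: k => // k IH; rewrite /N big_ord_recr/= addnS ltnS (leq_trans IH)// leq_addr.
have ae : {ae P, forall w, cvgn (fun k => S (N k) w)}.
  apply: (ae_cvg_of_fast (S := fun k => S (N k))) => // k.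
  by apply: fP => //; exact: leq_trans (fN k) (NS k).
(* The upper limit is defined and measurable everywhere; where the subsequence converges it is the
   limit. *)
pose L w := limn_esup (fun k => (S (N k) w)%:E).
have mS n : measurable_fun setT (S n) by exact: Lfun_measurable (S2 n).
have mL : measurable_fun setT L.
  by apply: measurable_fun_limn_esup => k; apply/measurable_EFinP.
pose T w := fine (L w).
have mT : measurable_fun setT T by exact: measurableT_comp.
have LT w : cvgn (fun k => S (N k) w) -> S (N k) w @[k --> \oo] --> T w.
  move=> cw; suff <- : limn (fun k => S (N k) w) = T w by [].
  have cL : (S (N k) w)%:E @[k --> \oo] --> (limn (fun k => S (N k) w))%:E.
    by apply: cvg_EFin cw; exact: nearW.
  by rewrite /T /L (cvg_limn_einf_sup cL).2.
have D2 n k : (fun w => S n w - S k w) \in L2 by exact: Lfun2B.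
have bound e n : 0 < e ->
    (forall k, (n <= k)%N -> mean (fun w => (S n w - S k w) ^+ 2) <= e) ->
    (\int[P]_w ((S n w - T w) ^+ 2)%:E <= e%:E)%E.
  move=> e1 He.
  pose u k w : \bar R := ((S n w - S (N k) w) ^+ 2)%:E.
  have mu k : measurable_fun setT (u k).
    by apply/measurable_EFinP; exact: Lfun_measurable (Lfun2_sqr (D2 _ _)).
  have u0 k w : (0 <= u k w)%E by rewrite lee_fin sqr_ge0.
  apply: (@le_trans _ _ (\int[P]_w limn_einf (u ^~ w))%E).
    apply: ae_ge0_le_integral => //.
    - by move=> w _; rewrite lee_fin sqr_ge0.
    - by apply/measurable_EFinP; apply: measurable_funX; exact: measurable_funB.
    - move=> w _; rewrite limn_einf_lim; apply: lime_ge; first exact: is_cvg_einfs.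
      by apply: nearW => k; apply: le_ereal_inf_tmp => _ [j _ <-].
    - rewrite /limn_einf; apply: measurableT_comp => //.
      by apply: measurable_fun_limn_esup => k; exact: measurableT_comp.
    - apply: filterS ae => w cw _.
      have cu : u k w @[k --> \oo] --> ((S n w - T w) ^+ 2)%:E.
        have cd : S n w - S (N k) w @[k --> \oo] --> S n w - T w.
          by apply: cvgB; [exact: cvg_cst|exact: LT].
        have cd2 : (S n w - S (N k) w) ^+ 2 @[k --> \oo] --> (S n w - T w) ^+ 2.
          exact: (cvgM cd cd).
        by apply: cvg_EFin cd2; exact: nearW.
      by rewrite (cvg_limn_einf_sup cu).1.
  apply: (le_trans (fatou _ _ _ _)) => //.
  rewrite limn_einf_lim; apply: lime_le; first exact: is_cvg_einfs.
  (* The infimum over a tail is at most its first member, and [k <= N k] brings [N k] into the range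
     of [He]. *)
  exists n => // k /= nk.
  apply: (@le_trans _ _ (\int[P]_w u k w)%E).
    by apply: ereal_inf_lbound; exists k => //=.
  have -> : (\int[P]_w u k w = (mean (fun w => (S n w - S (N k) w) ^+ 2))%:E)%E.
    by rewrite meanK ?Lfun2_sqr// unlock.
  by rewrite lee_fin He// (leq_trans nk).
have intL e n : (\int[P]_w ((S n w - T w) ^+ 2)%:E <= e%:E)%E ->
    (fun w => S n w - T w) \in L2.
  move=> le; apply/Lfun2P; split; first exact: measurable_funB.
  apply/Lfun1_integrable/integrableP; split.
    by apply/measurable_EFinP; apply: measurable_funX; exact: measurable_funB.
  under eq_integral do rewrite gee0_abs ?lee_fin ?sqr_ge0//.
  by rewrite (le_lt_trans le)// ltey.
have Tlim e : 0 < e -> exists n0, forall n, (n0 <= n)%N ->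
    (\int[P]_w ((S n w - T w) ^+ 2)%:E <= e%:E)%E.
  move=> e1; have [n0 Hn0] := cS e e1; exists n0 => n nn0.
  by apply: bound => // k nk; apply: Hn0 => //; exact: leq_trans nn0 nk.
have T2 : T \in L2.
  have [n0 Hn0] := Tlim 1 ltr01; have := intL _ _ (Hn0 _ (leqnn _)).
  move/(Lfun2B (S2 n0)); rewrite (_ : (fun w => S n0 w - (S n0 w - T w)) = T)//.
  by apply/funext => w; ring.
exists T => //; apply/cvgr0Pnorm_le => e e1.
have [n0 Hn0] := Tlim _ e1; exists n0 => // n /= nn0.
rewrite ger0_norm; last by apply: mean_ge0 => w; exact: sqr_ge0.
have := Hn0 _ nn0; rewrite -lee_fin meanK; first by rewrite unlock.
exact: Lfun2_sqr (Lfun2B _ _).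
Qed.

End MeanSquareCompleteness.

(** * The uniform law on the sphere *)

Section UniformLaw.
Context {R : realType} {disp : measure_display} {Omega : measurableType disp}.
Variables (P : probability Omega R) (d : nat) (U : Omega -> 'cV[R]_d.+1).
Hypothesis unifU : uniform_on_sphere P U.
Implicit Types (x y z v : 'cV[R]_d.+1) (p q : {poly R}).

Local Notation mean := (mean P).

Lemma measurable_dotv x : measurable_fun setT (fun w => dotv x (U w)).
Proof.
have [mU _ _] := unifU.
have -> : (fun w => dotv x (U w)) = (fun w => \sum_i x i 0 * entry U i w).
  by apply/funext => w; rewrite dotvE.
by apply: measurable_sum => i; apply: measurable_funM.
Qed.

Lemma measurable_dotv_horner x p : measurable_fun setT (fun w => p.[dotv x (U w)]).
Proof.
apply: (measurableT_comp (f := horner p)); last exact: measurable_dotv.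
by apply: continuous_measurable_fun; exact: continuous_horner.
Qed.

Lemma measurable_sphere : measurable [set w | sphere d (U w)].
Proof.
have [mU _ _] := unifU.
have -> : [set w | sphere d (U w)] = (fun w => \sum_i entry U i w ^+ 2) @^-1` [set 1].
  apply/seteqP; split => w /=; rewrite /sphere/= /enorm dotvE.
    move=> /(congr1 (fun t => t ^+ 2)); rewrite sqr_sqrtr ?expr1n => [<-|].
      by apply: eq_bigr => i _; rewrite expr2.
    by rewrite sumr_ge0// => i _; rewrite -expr2 sqr_ge0.
  by move=> e; rewrite -sqrtr1 -e; congr Num.sqrt; apply: eq_bigr => i _; rewrite expr2.
apply: preimage_measurable; last exact: measurable_set1.
by apply: measurable_sum => i; apply: measurable_funX.
Qed.

Let sphereC0 : P (~` [set w | sphere d (U w)]) = 0%E.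
Proof.
have [_ U1 _] := unifU.
by rewrite probability_setC ?U1 ?subee//; exact: measurable_sphere.
Qed.

(** [U] lies on the sphere only almost surely, and a polynomial in [U] need not be bounded on the
    exceptional null event, which is therefore removed. *)
Lemma bounded_on_sphere_Lfun1 (f : Omega -> R) M : measurable_fun setT f ->
  (forall w, sphere d (U w) -> `|f w| <= M) -> f \in Lfun P 1.
Proof.
move=> mf fM; apply/Lfun1_integrable.
have mD := measurable_sphere.
apply/(negligible_integrable (measurableC mD)) => //; first exact/measurable_EFinP.
rewrite setDE setCK setTI.
apply: measurable_bounded_integrable => //.
- by rewrite (le_lt_trans (probability_le1 _ _))// ltey.
- exact: measurable_funTS.
- exists M; split; first exact: num_real.
  by move=> x Mx w /= /fM /le_trans; apply; exact: ltW.
Qed.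

Lemma eq_on_sphere_mean (f g : Omega -> R) : f \in Lfun P 1 -> g \in Lfun P 1 ->
  (forall w, sphere d (U w) -> f w = g w) -> mean f = mean g.
Proof.
move=> f1 g1 fg; congr fine; rewrite unlock.
apply: ae_eq_integral => //.
- by apply/measurable_EFinP; exact: Lfun_measurable f1.
- by apply/measurable_EFinP; exact: Lfun_measurable g1.
- exists (~` [set w | sphere d (U w)]); split => //.
    by apply: measurableC; exact: measurable_sphere.
  by move=> w /= H D; apply: H => _; rewrite fg.
Qed.

Lemma sphere_dotvv (u : 'cV[R]_d.+1) : sphere d u -> dotv u u = 1.
Proof.
rewrite /sphere/= /enorm => /(congr1 (fun t => t ^+ 2)).
by rewrite sqr_sqrtr ?dotvv_ge0 ?expr1n.
Qed.

Lemma dotv_horner_bound x p (u : 'cV[R]_d.+1) : sphere d u ->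
  `|p.[dotv x u]| <= \sum_(i < size p) `|p`_i| * Num.sqrt (dotv x x) ^+ i.
Proof.
move=> /sphere_dotvv u1; rewrite horner_coef (le_trans (ler_norm_sum _ _ _))//.
apply: ler_sum => i _; rewrite normrM normrX ler_wpM2l// lerXn2r ?nnegrE ?sqrtr_ge0//.
rewrite -sqrtr_sqr ler_wsqrtr// (le_trans (dotv_cauchy_schwarz _ _))//.
by rewrite u1 mulr1.
Qed.

Definition zonal x y p q w := p.[dotv x (U w)] * q.[dotv y (U w)].

Lemma zonal_Lfun1 x y p q : zonal x y p q \in Lfun P 1.
Proof.
apply: (@bounded_on_sphere_Lfun1 _
  ((\sum_(i < size p) `|p`_i| * Num.sqrt (dotv x x) ^+ i) *
   (\sum_(i < size q) `|q`_i| * Num.sqrt (dotv y y) ^+ i))).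
  by apply: measurable_funM; exact: measurable_dotv_horner.
by move=> w Uw; rewrite normrM ler_pM// dotv_horner_bound.
Qed.

(** The bilinear form to which the abstract Gegenbauer results are applied. *)
Definition zmean x y p q := mean (zonal x y p q).

(** As [x'(QU) = (Q'x)'U], both integrands are one continuous function [phi], evaluated at [QU] and
    at [U]; invariance on the Borel sets [phi^-1(A)] gives them the same law. *)
Lemma zmean_mulmx (Q : 'M[R]_d.+1) x y p q : orthogonal_mx Q ->
  zmean (Q^T *m x) (Q^T *m y) p q = zmean x y p q.
Proof.
move=> oQ; have [_ _ inv] := unifU; rewrite /zmean /mean; congr fine; rewrite unlock.
pose phi u : R := p.[dotv x u] * q.[dotv y u].
have phiE w : phi (Q *m U w) = zonal (Q^T *m x) (Q^T *m y) p q w.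
  by rewrite /phi !dotv_mulmxr.
have m1 := Lfun_measurable (zonal_Lfun1 x y p q).
have m2 := Lfun_measurable (zonal_Lfun1 (Q^T *m x) (Q^T *m y) p q).
have E f : measurable_fun setT f -> f \in Lfun P 1 ->
    (\int[P]_w (f w)%:E = \int[pushforward P f]_t t%:E)%E.
  by move=> mf /Lfun1_integrable f1; rewrite (integral_pushforward mf).
rewrite (E _ m1 (zonal_Lfun1 _ _ _ _)) (E _ m2 (zonal_Lfun1 _ _ _ _)).
apply: eq_measure_integral => A mA _; rewrite /pushforward.
have := inv Q (phi @^-1` A) oQ (borel_cV_preimage (@continuous_dotv_horner _ _ _ _ _ _) mA).
rewrite [X in P X = _](_ : _ = zonal (Q^T *m x) (Q^T *m y) p q @^-1` A)//.
by apply/seteqP; split => w /=; rewrite phiE.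
Qed.

Lemma zmeanDl x y p p' q : zmean x y (p + p') q = zmean x y p q + zmean x y p' q.
Proof.
rewrite /zmean -meanD ?zonal_Lfun1//; apply: meanE => w.
by rewrite /zonal hornerD mulrDl.
Qed.

Lemma zmeanC x y p q : zmean x y p q = zmean y x q p.
Proof. by apply: meanE => w; rewrite /zonal mulrC. Qed.

Lemma zmeanDr x y p q q' : zmean x y p (q + q') = zmean x y p q + zmean x y p q'.
Proof. by rewrite !(zmeanC x) zmeanDl. Qed.

Lemma zmeanZl x y a p q : zmean x y (a%:P * p) q = a * zmean x y p q.
Proof.
rewrite /zmean -meanZ ?zonal_Lfun1//; apply: meanE => w.
by rewrite /zonal hornerM hornerC mulrA.
Qed.

Lemma zmeanZr x y a p q : zmean x y p (a%:P * q) = a * zmean x y p q.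
Proof. by rewrite !(zmeanC x) zmeanZl. Qed.

Lemma zmean11 x y : zmean x y 1 1 = 1.
Proof. by rewrite -[RHS](mean_cst P); apply: meanE => w; rewrite /zonal !hornerC mulr1. Qed.

(* Invariance under the reflection in the hyperplane orthogonal to [z]. *)
Lemma zmean_orth v z j : dotv v z = 0 -> zmean v z 'X^j 'X = 0.
Proof.
move=> vz; have [->|z0] := eqVneq z 0.
  rewrite -[RHS](mean_cst P); apply: meanE => w; rewrite /zonal hornerX.
  by rewrite [dotv 0 _]dotvE big1 ?mulr0// => i _; rewrite mxE mul0r.
have zz : dotv z z != 0 by rewrite dotvv_eq0.
pose a : R := 2 / dotv z z.
pose Q : 'M[R]_d.+1 := 1%:M - a *: (z *m z^T).
have QT : Q^T = Q.
  by rewrite /Q linearB linearZ/= trmx_mul trmxK trmx1.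
have Qx x : Q *m x = x - (a * dotv z x) *: z.
  rewrite /Q mulmxBl mul1mx -scalemxAl -mulmxA.
  have -> : z^T *m x = (dotv z x)%:M.
    by apply/matrixP => i k; rewrite !ord1 !mxE eqxx mulr1n /dotv mxE.
  by rewrite mul_mx_scalar scalerA.
have Qv : Q *m v = v by rewrite Qx dotvC vz mulr0 scale0r subr0.
have Qz : Q *m z = - z.
  by rewrite Qx /a divfK// scaler_nat mulr2n opprD addrA subrr add0r.
have oQ : orthogonal_mx Q.
  rewrite /orthogonal_mx QT; apply/matrixP => i k.
  have -> : (Q *m Q) i k = (Q *m (Q *m (delta_mx k 0 : 'cV[R]_d.+1))) i 0.
    by rewrite mulmxA -colE [RHS]mxE.
  rewrite !Qx dotvBr dotvZr.
  have -> : a * (dotv z (delta_mx k 0) - a * dotv z (delta_mx k 0) * dotv z z) =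
     - (a * dotv z (delta_mx k 0)) by rewrite /a; field.
  rewrite scaleNr opprK subrK !mxE eqxx andbT.
  by [].
have := zmean_mulmx v z 'X^j 'X oQ; rewrite QT Qv Qz.
have -> : zmean v (- z) 'X^j 'X = - zmean v z 'X^j 'X.
  rewrite -mulN1r -zmeanZr; apply: meanE => w.
  by rewrite /zonal hornerM hornerC !hornerX dotvNl mulN1r.
lra.
Qed.

End UniformLaw.

(** * Mixed moments of two linear forms of [U] *)

Section UniformMoments.
Context {R : realType} {disp : measure_display} {Omega : measurableType disp}.
Variables (P : probability Omega R) (d : nat) (U : Omega -> 'cV[R]_d.+1).
Hypothesis unifU : uniform_on_sphere P U.
Implicit Types (x y z v : 'cV[R]_d.+1) (p q : {poly R}).

Local Notation mean := (mean P).
Local Notation zmean := (zmean P U).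
Local Notation zonal := (zonal U).

Lemma zmeanDvr x y z p : zmean x (y + z) p 'X = zmean x y p 'X + zmean x z p 'X.
Proof.
rewrite /zmean -meanD ?zonal_Lfun1//; apply: meanE => w.
by rewrite /zonal !hornerX dotvDl mulrDr.
Qed.

Lemma zmeanZvr x y a p : zmean x (a *: y) p 'X = a * zmean x y p 'X.
Proof.
rewrite /zmean -meanZ ?zonal_Lfun1//; apply: meanE => w.
by rewrite /zonal !hornerX dotvZl mulrCA.
Qed.

(** The binomial theorem makes the mean a polynomial in [s] with mixed moments as coefficients, so
    that identities in [s] can be compared coefficientwise. *)
Lemma mean_lincomb_expn x y s j a b :
  mean (fun w => dotv (s *: x + y) (U w) ^+ j * (dotv x (U w) ^+ a * dotv y (U w) ^+ b)) =
  \sum_(i < j.+1) 'C(j, i)%:R * zmean x y 'X^(i + a) 'X^(j - i + b) * s ^+ i.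
Proof.
transitivity (mean (fun w => \sum_(i < j.+1)
    ('C(j, i)%:R * s ^+ i) * zonal x y 'X^(i + a) 'X^(j - i + b) w)).
  apply: meanE => w; rewrite dotvDl dotvZl addrC exprDn mulr_suml.
  apply: eq_bigr => i _; rewrite /zonal !hornerXn exprMn !exprD -mulr_natl; ring.
rewrite mean_lsum => [|i]; last first.
  by apply: (@LfunZ _ _ _ _ _ _ 1) => //; exact: zonal_Lfun1.
apply: eq_bigr => i _; rewrite meanZ ?zonal_Lfun1// mulrAC; rewrite /zmean; ring.
Qed.

Lemma zmean_lincomb_l x y s j : zmean (s *: x + y) x 'X^j 'X =
  (\poly_(i < j.+1) ('C(j, i)%:R * zmean x y 'X^(i + 1) 'X^(j - i))).[s].
Proof.
transitivity (mean (fun w => dotv (s *: x + y) (U w) ^+ j *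
    (dotv x (U w) ^+ 1 * dotv y (U w) ^+ 0))).
  by apply: meanE => w; rewrite /zonal hornerXn ?hornerX ?hornerC ?expr1 expr0 ?mulr1 ?mul1r.
by rewrite mean_lincomb_expn horner_poly; apply: eq_bigr => i _; rewrite ?addn0.
Qed.

Lemma zmean_lincomb_r x y s j : zmean (s *: x + y) y 'X^j 'X =
  (\poly_(i < j.+1) ('C(j, i)%:R * zmean x y 'X^i 'X^(j - i + 1))).[s].
Proof.
transitivity (mean (fun w => dotv (s *: x + y) (U w) ^+ j *
    (dotv x (U w) ^+ 0 * dotv y (U w) ^+ 1))).
  by apply: meanE => w; rewrite /zonal hornerXn ?hornerX ?hornerC ?expr1 expr0 ?mulr1 ?mul1r.
by rewrite mean_lincomb_expn horner_poly; apply: eq_bigr => i _; rewrite ?addn0.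
Qed.

Lemma zmean_lincomb_1 x y s j : zmean (s *: x + y) y 'X^j 1 =
  (\poly_(i < j.+1) ('C(j, i)%:R * zmean x y 'X^i 'X^(j - i))).[s].
Proof.
transitivity (mean (fun w => dotv (s *: x + y) (U w) ^+ j *
    (dotv x (U w) ^+ 0 * dotv y (U w) ^+ 0))).
  by apply: meanE => w; rewrite /zonal hornerXn ?hornerX ?hornerC ?expr1 expr0 ?mulr1 ?mul1r.
by rewrite mean_lincomb_expn horner_poly; apply: eq_bigr => i _; rewrite ?addn0.
Qed.

(* First-order term in [s] of the vanishing mean of
   [((v + s z)'U)^(j+1) ((s |z|^2 v - |v|^2 z)'U)]. *)
Lemma zmean_orth_sqr v z j : dotv v z = 0 ->
  dotv z z * zmean v z 'X^(j.+2) 1 = j.+1%:R * dotv v v * zmean v z 'X^j 'X^2.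
Proof.
move=> vz.
pose p := (dotv z z)%:P * ('X * \poly_(i < j.+2)
    ('C(j.+1, i)%:R * zmean z v 'X^i 'X^(j.+1 - i + 1))) -
  (dotv v v)%:P * \poly_(i < j.+2) ('C(j.+1, i)%:R * zmean z v 'X^(i + 1) 'X^(j.+1 - i)).
have : p = 0.
  apply: poly_unit_itv_eq0 => s _; rewrite /p hornerD hornerN !hornerM !hornerC hornerX.
  rewrite -zmean_lincomb_l -zmean_lincomb_r -mulN1r !mulrA mulN1r.
  have := @zmean_orth _ _ _ _ _ _ unifU (s *: z + v)
    ((s * dotv z z) *: v - dotv v v *: z) j.+1.
  rewrite -scaleNr zmeanDvr !zmeanZvr => H.
  rewrite -[RHS]H; first by congr (_ + _); ring.
  by rewrite !(dotvDr, dotvDl, dotvZl, dotvZr) (dotvC z v) vz; ring.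
move=> /(congr1 (fun p : {poly R} => p`_1)).
rewrite /p coefB !coefCM coefXM !coef_poly/= coef0 bin0 bin1 mul1r subn0 subSS subn0 addn1.
rewrite !(zmeanC P U z) => /eqP; rewrite subr_eq0 => /eqP ->.
by ring.
Qed.

Lemma zmean_cst_r x y z p : zmean x y p 1 = zmean x z p 1.
Proof. by apply: meanE => w; rewrite /zonal !hornerC. Qed.

(* Sum of [zmean_orth_sqr] over the components [z_i] orthogonal to [v] of the
   canonical basis, using [|U| = 1]. *)
Lemma zmean_recur v j : (j.+1 + d)%:R * zmean v v 'X^(j.+2) 1 =
  j.+1%:R * dotv v v * zmean v v 'X^j 1.
Proof.
have [->|v0] := eqVneq v 0.
  have z0 (u : 'cV[R]_d.+1) : dotv 0 u = 0.
    by rewrite dotvE big1// => i _; rewrite mxE mul0r.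
  rewrite z0 mulr0 mul0r; apply/eqP; rewrite mulf_eq0; apply/orP; right; apply/eqP.
  rewrite -[RHS](mean_cst P); apply: meanE => w.
  by rewrite /zonal hornerXn z0 expr0n mul0r.
set n := dotv v v.
have n0 : n != 0 by rewrite dotvv_eq0.
pose e (i : 'I_d.+1) : 'cV[R]_d.+1 := delta_mx i 0.
pose z i := n *: e i - v i 0 *: v.
have ev i u : dotv (e i) u = u i 0 by exact: dotv_delta.
have vz i : dotv v (z i) = 0.
  by rewrite dotvBr !dotvZr (dotvC v) ev -/n mulrC subrr.
have zz i : dotv (z i) (z i) = n ^+ 2 - v i 0 ^+ 2 * n.
  rewrite {1}/z dotvBl !dotvZl vz mulr0 subr0 dotvBr !dotvZr !ev mxE !eqxx/=.
  by ring.
have sv2 : \sum_i v i 0 ^+ 2 = n.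
  by rewrite /n dotvE; apply: eq_bigr => i _; rewrite expr2.
have szz : \sum_i dotv (z i) (z i) = d%:R * n ^+ 2.
  under eq_bigr do rewrite zz.
  rewrite sumrB -[X in _ - X]mulr_suml sv2 sumr_const card_ord -[n ^+ 2 *+ _]mulr_natl.
  by rewrite -natr1; ring.
have szm : \sum_i zmean v (z i) 'X^j 'X^2 =
    n ^+ 2 * zmean v v 'X^j 1 + (- n) * zmean v v 'X^(j.+2) 1.
  have L1 p q y : zonal v y p q \in Lfun P 1 by exact: zonal_Lfun1.
  rewrite /zmean -mean_lsum// -!meanZ// -meanD; [|exact: (@LfunZ _ _ _ _ _ _ 1)..].
  apply: (eq_on_sphere_mean unifU).
  - exact: (@Lfun_lsum _ _ _ _ 1).
  - by apply: (@LfunD _ _ _ _ _ _ 1) => //; exact: (@LfunZ _ _ _ _ _ _ 1).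
  - move=> w /sphere_dotvv; rewrite dotvE => Uw.
    rewrite /zonal !hornerXn hornerC; under eq_bigr do rewrite !hornerXn.
    rewrite -mulr_sumr; set T := dotv v (U w).
    have -> : \sum_i dotv (z i) (U w) ^+ 2 = n ^+ 2 - n * T ^+ 2.
      transitivity (\sum_i (n ^+ 2 * (U w i 0 * U w i 0)
          - (2 * n * T) * (v i 0 * U w i 0) + T ^+ 2 * v i 0 ^+ 2)).
        apply: eq_bigr => i _; rewrite dotvBl !dotvZl ev -/T; ring.
      rewrite big_split sumrB/= -!mulr_sumr Uw sv2 -dotvE -/T; ring.
    have -> : T ^+ j.+2 = T ^+ j * T ^+ 2 by rewrite -exprD addn2.
    by ring.
have H i : dotv (z i) (z i) * zmean v v 'X^(j.+2) 1 =
    j.+1%:R * n * zmean v (z i) 'X^j 'X^2.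
  by rewrite -(zmean_orth_sqr j (vz i)); congr (_ * _); exact: zmean_cst_r.
have S : d%:R * n ^+ 2 * zmean v v 'X^(j.+2) 1 = j.+1%:R * n *
    (n ^+ 2 * zmean v v 'X^j 1 + (- n) * zmean v v 'X^(j.+2) 1).
  by rewrite -szz -szm mulr_suml mulr_sumr; exact: eq_bigr.
apply: (mulfI (expf_neq0 2 n0)).
rewrite natrD; set a := zmean _ _ _ _ in S *; set b := zmean _ _ _ _ in S *.
transitivity (d%:R * n ^+ 2 * a + j.+1%:R * n ^+ 2 * a); first ring.
rewrite S; ring.
Qed.

(** [|v|^2 y - (v'y) v] is orthogonal to [v], so [zmean_orth] reduces [y'U] to a multiple of [v'U],
    and [zmean_recur] lowers the exponent. *)
Lemma zmean_recur2 v y j :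
  (j + d)%:R * zmean v y 'X^j 'X = j%:R * dotv v y * zmean v y 'X^(j.-1) 1.
Proof.
case: j => [|j].
  have -> : zmean v y 'X^0 'X = 0; last by rewrite mulr0 !mul0r.
  (* With exponent 0 the first vector does not matter, and the zero vector is orthogonal to every
     [y]. *)
  rewrite -(zmean_orth unifU 0 (v := 0) (z := y)); last first.
    by rewrite dotvE big1// => i _; rewrite mxE mul0r.
  by apply: meanE => w; rewrite /zonal !expr0 !hornerC.
have [->|v0] := eqVneq v 0.
  have z0 (u : 'cV[R]_d.+1) : dotv 0 u = 0.
    by rewrite dotvE big1// => i _; rewrite mxE mul0r.
  rewrite z0 mulr0 mul0r; apply/eqP; rewrite mulf_eq0; apply/orP; right; apply/eqP.
  rewrite -[RHS](mean_cst P); apply: meanE => w.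
  by rewrite /zonal hornerXn z0 expr0n mul0r.
have n0 : dotv v v != 0 by rewrite dotvv_eq0.
have vz : dotv v (dotv v v *: y - dotv v y *: v) = 0.
  by rewrite dotvBr !dotvZr mulrC subrr.
have := zmean_orth unifU j.+1 vz; rewrite -scaleNr zmeanDvr !zmeanZvr mulNr => /eqP.
rewrite subr_eq0 => /eqP E.
have E1 : zmean v v 'X^(j.+1) 'X = zmean v v 'X^(j.+2) 1.
  apply: meanE => w; rewrite /zonal !hornerXn hornerX hornerC mulr1 [in RHS]exprS; ring.
apply: (mulfI n0).
have -> : dotv v v * ((j.+1 + d)%:R * zmean v y 'X^(j.+1) 'X) =
    (j.+1 + d)%:R * (dotv v v * zmean v y 'X^(j.+1) 'X) by ring.
rewrite E E1 mulrCA zmean_recur (zmean_cst_r v y v); ring.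
Qed.

End UniformMoments.

(** * The Green formula and the reproducing identity *)

Section ZonalReproducing.
Context {R : realType} {disp : measure_display} {Omega : measurableType disp}.
Variables (P : probability Omega R) (d : nat) (U : Omega -> 'cV[R]_d.+1).
Hypothesis unifU : uniform_on_sphere P U.
Implicit Types (x y : 'cV[R]_d.+1) (g h : {poly R}).

Local Notation zmean := (zmean P U).

Lemma linear_poly_eq0 (f : {poly R} -> R) :
  (forall p q, f (p + q) = f p + f q) -> (forall a p, f (a%:P * p) = a * f p) ->
  (forall n, f 'X^n = 0) -> forall p, f p = 0.
Proof.
move=> fD fZ fX p; rewrite -[p]coefK poly_def.
apply: (big_ind (fun q => f q = 0)) => [|q r fq fr|i _].
- by have := fZ 0 0; rewrite mulr0 mul0r.
- by rewrite fD fq fr addr0.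
- by rewrite -mul_polyC fZ fX mulr0.
Qed.

(** Coefficient of [s^a] in [zmean_recur2] for the vectors [s x + y] and [y] with exponent [a + b];
    their inner product is [s x'y + 1]. *)
Lemma zmean_monomials x y a b : dotv y y = 1 ->
  (a + b + d)%:R * zmean x y 'X^a 'X^(b.+1) =
  a%:R * dotv x y * zmean x y 'X^(a.-1) 'X^b + b%:R * zmean x y 'X^a 'X^(b.-1).
Proof.
move=> yy; set j := (a + b)%N.
pose p := (j + d)%:R%:P *
    \poly_(i < j.+1) ('C(j, i)%:R * zmean x y 'X^i 'X^(j - i + 1)) -
  j%:R%:P * ((dotv x y)%:P * 'X + 1) *
    \poly_(i < j.-1.+1) ('C(j.-1, i)%:R * zmean x y 'X^i 'X^(j.-1 - i)).
have : p = 0.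
  apply: poly_unit_itv_eq0 => s _; rewrite /p hornerD hornerN !hornerM !hornerC.
  rewrite hornerD hornerM !hornerC hornerX -zmean_lincomb_r// -zmean_lincomb_1//.
  rewrite (zmean_recur2 unifU) dotvDl dotvZl yy; ring.
move=> /(congr1 (fun p : {poly R} => p`_a)) /eqP.
have aj : (a < j.+1)%N by rewrite ltnS leq_addr.
have ja : (j - a = b)%N by rewrite /j addKn.
rewrite coefB -mulrA !coefCM mulrDl mul1r coefD -mulrA coefCM coefXM !coef_poly aj.
rewrite coef0 subr_eq0 ja addn1 => /eqP E.
have C0 : 'C(j, a)%:R != 0 :> R by rewrite pnatr_eq0 -lt0n bin_gt0 leq_addr.
(* The two summands match by [j C(j-1, a-1) = a C(j, a)] and [j C(j-1, a) = b C(j, a)]. *)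
apply: (mulfI C0); rewrite mulrCA E mulrDr mulrDr; congr (_ + _).
  rewrite {p E} /j in aj ja C0 *; case: a aj ja C0 => [|a'] aj ja C0.
    by rewrite !mulr0 !mul0r mulr0.
  rewrite addSn/= leq_addr addKn.
  have := congr1 (fun n => n%:R : R) (mul_bin_diag (a' + b).+1 a'); rewrite !natrM => e.
  transitivity ((a' + b).+1%:R * 'C(a' + b, a')%:R * (dotv x y * zmean x y 'X^a' 'X^b)).
    ring.
  by rewrite e/=; ring.
have := congr1 (fun n => n%:R : R) (mul_bin_down j a); rewrite !natrM ja => e.
rewrite {p E aj} /j in ja e C0 *; case: b ja e C0 => [|b'] ja e C0.
  rewrite mul0r mulr0; case: ifP => _; last by rewrite mulr0.
  by rewrite mulrA e mul0r mul0r.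
rewrite addnS/= ltnS leq_addr addKn mulrA.
by rewrite addnS/= in e; rewrite e; ring.
Qed.

(** Both sides are bilinear, so monomials suffice. For them the second and third terms on the left
    contribute the [a + b] in the factor [a + b + d] of [zmean_monomials]. *)
Lemma zmean_green x y g h : dotv y y = 1 ->
  dotv x y * zmean x y g^`() h - zmean x y ('X * g^`()) ('X * h) +
  zmean x y g ((1 - 'X ^+ 2) * h^`()) = d%:R * zmean x y g ('X * h).
Proof.
move=> yy; apply/eqP; rewrite -subr_eq0; apply/eqP.
have Dl := zmeanDl unifU x y; have Dr := zmeanDr unifU x y.
have Zl := zmeanZl unifU x y; have Zr := zmeanZr unifU x y.
move: g; apply: linear_poly_eq0 => [p q|a p|a].
- rewrite derivD mulrDr !Dl; ring.
- by rewrite derivM derivC mul0r add0r (mulrCA 'X) !Zl; ring.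
move: h; apply: linear_poly_eq0 => [p q|b p|b].
- rewrite derivD !mulrDr !Dr; ring.
- by rewrite derivM derivC mul0r add0r !(mulrCA 'X) (mulrCA (1 - _)) !Zr; ring.
have cstn (n : nat) (p : {poly R}) : p *+ n = n%:R%:P * p.
  by rewrite polyC_natr mulr_natl.
rewrite !derivXn !cstn !(mulrCA 'X) (mulrCA (1 - _)) !Zl !Zr.
have XX n (p : {poly R}) : n%:R * zmean x y ('X * 'X^(n.-1)) p = n%:R * zmean x y 'X^n p.
  by case: n => [|n]; rewrite ?mul0r//= -exprS.
rewrite XX -exprS.
have -> : (1 - 'X ^+ 2) * 'X^(b.-1) = 'X^(b.-1) + (-1)%:P * ('X * ('X * 'X^(b.-1))) 
    :> {poly R}.
  by rewrite polyCN polyC1; ring.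
rewrite Dr Zr.
have XXb : b%:R * zmean x y 'X^a ('X * ('X * 'X^(b.-1))) = b%:R * zmean x y 'X^a 'X^(b.+1).
  by case: (b) => [|n]; rewrite ?mul0r//= -!exprS.
have := zmean_monomials x a b yy; rewrite !natrD => E.
move: XXb E; set Q := zmean x y 'X^a ('X * _); set M := zmean x y 'X^a 'X^(b.+1).
set M1 := zmean x y 'X^(a.-1) _; set M2 := zmean x y 'X^a 'X^(b.-1); lra.
Qed.

Lemma gegenbauer_zonal_mean (G : nat -> {poly R}) x y n : (2 <= d)%N ->
  is_gegenbauer ((d%:R - 1) / 2) G -> sphere d x -> sphere d y ->
  alpha d n ^+ 2 * zmean x y (G n) (G n) = (G n).[dotv x y].
Proof.
move=> d2 GG /sphere_dotvv xx /sphere_dotvv yy.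
have d1 : 1 < d%:R :> R by rewrite ltr1n.
pose l : R := (d%:R - 1) / 2.
have l0 : 0 < l by rewrite divr_gt0// subr_gt0.
have [G0 G1 Gr] := gegenbauer_rec GG.
have dl : d%:R = 2 * l + 1 by rewrite /l; field.
have greenr g h : dotv x y * zmean x y g^`() h - zmean x y ('X * g^`()) ('X * h) +
  zmean x y g ((1 - 'X ^+ 2) * h^`()) = (2 * l + 1) * zmean x y g ('X * h).
  by rewrite -dl zmean_green.
have greenl g h : dotv x y * zmean x y h g^`() - zmean x y ('X * h) ('X * g^`()) +
  zmean x y ((1 - 'X ^+ 2) * h^`()) g = (2 * l + 1) * zmean x y ('X * h) g.
  by rewrite !(zmeanC P U x) dotvC -dl zmean_green.
have := gegenbauer_reproducing l0 G0 G1 Gr (zmeanDl unifU x y) (zmeanDr unifU x y)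
  (zmeanZl unifU x y) (zmeanZr unifU x y) (zmean11 P U x y) greenr greenl n.
have -> : alpha d n ^+ 2 = (n%:R + l) / l.
  rewrite /alpha sqr_sqrtr; last by rewrite divr_ge0// ?subr_ge0 ?ltW// ltr_wpDl.
  by rewrite /l; field; rewrite subr_eq0 gt_eqF.
by move=> E; apply: (mulfI (lt0r_neq0 l0)); rewrite -E; field; rewrite gt_eqF.
Qed.

End ZonalReproducing.

(** * The terms of the series *)

Section FieldTerms.
Context {R : realType} {disp : measure_display} {Omega : measurableType disp}.
Variables (P : probability Omega R) (T : zmodType) (m d : nat).
Variables (G : nat -> {poly R}) (B : nat -> T -> 'M[R]_m).
Variables (V : nat -> T -> Omega -> 'cV[R]_m) (U : Omega -> 'cV[R]_d.+1).
Hypothesis d_ge2 : (2 <= d)%N.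
Hypothesis GG : is_gegenbauer ((d%:R - 1) / 2) G.
Hypothesis V2 : forall n t, second_order P (V n t).
Hypothesis V_mean : forall n t, meanv P (V n t) = 0.
Hypothesis V_cov : forall n t1 t2,
  covmx P (V n t1) (V n t2) = (alpha d n) ^+ 2 *: B n (t1 - t2).
Hypothesis unifU : uniform_on_sphere P U.
Hypothesis indUV : independent_vector_processes P U V.

Local Notation mean := (mean P).
Local Notation zmean := (zmean P U).
Local Notation zonal := (zonal U).
Local Notation L2 := (Lfun P 2%:E).
Implicit Types (x y : 'cV[R]_d.+1) (t : T) (i j : 'I_m).

Lemma sigma_of_U (phi : 'cV[R]_d.+1 -> R) (A : set R) : continuous phi -> measurable A ->
  sigma_of (fun _ : unit => U) ((fun w => phi (U w)) @^-1` A).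
Proof.
move=> cphi mA; apply: sub_sigma_algebra; exists tt => /=.
by exists (phi @^-1` A); [exact: borel_cV_preimage|rewrite setTI].
Qed.

(** Measurability is taken with respect to the sigma-algebra of the whole process, so that products
    of entries at different times remain in it. *)
Lemma sigma_of_measurable_fun n t i : measurable_fun
  (setT : set (g_sigma_algebraType [set S | exists t,
     preimage_set_system setT (V n t) (@borel_cV R m) S])) (entry (V n t) i).
Proof.
move=> _ A mA; rewrite setTI; apply: sub_sigma_algebra; exists t => /=.
exists ((fun v : 'cV[R]_m => v i 0) @^-1` A); last by rewrite setTI.
by apply: borel_cV_preimage => //; exact: coord_continuous.
Qed.

Lemma sigma_of_entry n t i A : measurable A -> sigma_of (V n) (entry (V n t) i @^-1` A).
Proof.
by move=> mA; have := @sigma_of_measurable_fun n t i measurableT A mA; rewrite setTI.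
Qed.

Lemma sigma_of_entryM n t1 t2 i j A : measurable A ->
  sigma_of (V n) ((fun w => entry (V n t1) i w * entry (V n t2) j w) @^-1` A).
Proof.
move=> mA; have := measurable_funM (@sigma_of_measurable_fun n t1 i)
  (@sigma_of_measurable_fun n t2 j) measurableT mA.
by rewrite setTI.
Qed.

Lemma independent_U_V (phi : 'cV[R]_d.+1 -> R) n (Y : Omega -> R) : continuous phi ->
  (forall A, measurable A -> sigma_of (V n) (Y @^-1` A)) ->
  independent_rv P (fun w => phi (U w)) Y.
Proof.
move=> cphi sY A C mA mC.
have := indUV (s := [:: None; Some n])
  (A := fun o => if o is Some _ then Y @^-1` C else (fun w => phi (U w)) @^-1` A).
rewrite !big_cons !big_nil setIT mule1; apply=> // -[k|]; rewrite !inE.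
  by move=> /eqP[->]; exact: sY.
by move=> _; exact: sigma_of_U.
Qed.

(** The grouping isolates an entry of [V n], whose mean is 0, against everything else. *)
Lemma independent_V_V_U (phi : 'cV[R]_d.+1 -> R) n k t1 t2 i j : n != k -> continuous phi ->
  measurable_fun setT (fun w => phi (U w)) ->
  independent_rv P (entry (V n t1) i) (fun w => entry (V k t2) j w * phi (U w)).
Proof.
move=> nk cphi mphi; apply: independent_rv3 => //.
- exact: Lfun_measurable (V2 n t1 i).
- exact: Lfun_measurable (V2 k t2 j).
move=> A1 A2 A3 mA1 mA2 mA3.
have := indUV (s := [:: Some n; Some k; None])
  (A := fun o => if o is Some l then
     (if l == n then entry (V n t1) i @^-1` A1 else entry (V k t2) j @^-1` A2)
     else (fun w => phi (U w)) @^-1` A3).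
rewrite !big_cons !big_nil setIT mule1 eqxx eq_sym (negbTE nk); apply=> //.
  by rewrite /= !inE !orbF andbT; apply/eqP => -[/eqP]; rewrite (negbTE nk).
move=> [l|]; rewrite !inE; last by move=> _; exact: sigma_of_U.
case/orP => [/eqP[->]|/orP[/eqP[->]|//]].
  by rewrite eqxx; exact: sigma_of_entry.
by rewrite eq_sym (negbTE nk); exact: sigma_of_entry.
Qed.

Definition term n x t i w := (G n).[dotv x (U w)] * entry (V n t) i w.

Let p_Lfun1 p x : (fun w => p.[dotv x (U w)]) \in Lfun P 1.
Proof.
have := zonal_Lfun1 unifU x x p 1.
by rewrite (_ : zonal x x p 1 = (fun w => p.[dotv x (U w)]))//; apply/funext => w;
  rewrite /zonal hornerC mulr1.
Qed.

Let continuous_p (p : {poly R}) x : continuous (fun u => p.[dotv x u]).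
Proof.
have -> : (fun u => p.[dotv x u]) = (fun u => p.[dotv x u] * (1 : {poly R}).[dotv x u]).
  by apply/funext => u; rewrite hornerC mulr1.
exact: continuous_dotv_horner.
Qed.

Let mean_V n t i : mean (entry (V n t) i) = 0.
Proof. by have /matrixP/(_ i 0) := V_mean n t; rewrite !mxE. Qed.

Let mean_VV n t1 t2 i j : mean (fun w => entry (V n t1) i w * entry (V n t2) j w) =
  alpha d n ^+ 2 * B n (t1 - t2) i j.
Proof.
have /matrixP/(_ i j) := V_cov n t1 t2.
by rewrite !mxE (covarianceEmean (V2 n t1 i) (V2 n t2 j)) mean_V mul0r subr0.
Qed.

(** One use of independence separates the polynomials in [U] from the entries of [V n]. The
    integrability half is what places the terms in [L^2]. *)
Lemma termM_mean n x y t1 t2 i j :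
  (fun w => term n x t1 i w * term n y t2 j w) \in Lfun P 1 /\
  mean (fun w => term n x t1 i w * term n y t2 j w) =
    zmean x y (G n) (G n) * (alpha d n ^+ 2 * B n (t1 - t2) i j).
Proof.
have ind : independent_rv P (zonal x y (G n) (G n))
    (fun w => entry (V n t1) i w * entry (V n t2) j w).
  apply: (@independent_U_V (fun u => (G n).[dotv x u] * (G n).[dotv y u]) n).
    exact: continuous_dotv_horner.
  by move=> A mA; exact: sigma_of_entryM.
have [L1 E] := independent_rv_mean ind (zonal_Lfun1 unifU x y _ _)
  (Lfun2M (V2 n t1 i) (V2 n t2 j)).
rewrite mean_VV in E.
have e : (fun w => term n x t1 i w * term n y t2 j w) =
    (fun w => zonal x y (G n) (G n) w * (entry (V n t1) i w * entry (V n t2) j w)).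
  by apply/funext => w; rewrite /term /zonal; ring.
by rewrite e.
Qed.

Lemma term_Lfun2 n x t i : term n x t i \in L2.
Proof.
apply/Lfun2P; split.
  apply: measurable_funM; first exact: (measurable_dotv_horner unifU).
  exact: Lfun_measurable (V2 n t i).
have [+ _] := termM_mean n x x t t i i.
by rewrite (_ : (fun w => term n x t i w * _) = (fun w => term n x t i w ^+ 2)).
Qed.

Lemma term_mean n x t i : mean (term n x t i) = 0.
Proof.
have ind : independent_rv P (fun w => (G n).[dotv x (U w)]) (entry (V n t) i).
  apply: (@independent_U_V (fun u => (G n).[dotv x u]) n); first exact: continuous_p.
  by move=> A mA; exact: sigma_of_entry.
have [_] := independent_rv_mean ind (p_Lfun1 (G n) x) (Lfun2_Lfun1 (V2 n t i)).
by rewrite mean_V mulr0.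
Qed.

Lemma term_inner n x y t1 t2 i j : sphere d x -> sphere d y ->
  mean (fun w => term n x t1 i w * term n y t2 j w) =
  (G n).[dotv x y] * B n (t1 - t2) i j.
Proof.
move=> Sx Sy; rewrite (termM_mean n x y t1 t2 i j).2.
by rewrite -(gegenbauer_zonal_mean unifU n d_ge2 GG Sx Sy); ring.
Qed.

Lemma term_inner_neq n k x y t1 t2 i j : n != k ->
  mean (fun w => term n x t1 i w * term k y t2 j w) = 0.
Proof.
move=> nk; pose phi u := (G n).[dotv x u] * (G k).[dotv y u].
have cphi : continuous phi by exact: continuous_dotv_horner.
have L1 : (fun w => phi (U w)) \in Lfun P 1 := zonal_Lfun1 unifU x y (G n) (G k).
have ind : independent_rv P (fun w => phi (U w)) (entry (V k t2) j).
  by apply: (@independent_U_V phi k) => // A mA; exact: sigma_of_entry.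
have [L1' _] := independent_rv_mean ind L1 (Lfun2_Lfun1 (V2 k t2 j)).
have {}L1' : (fun w => entry (V k t2) j w * phi (U w)) \in Lfun P 1.
  by move: L1'; rewrite (_ : (fun w => phi (U w) * _) =
    (fun w => entry (V k t2) j w * phi (U w)))//; apply/funext => w; rewrite mulrC.
have ind' := independent_V_V_U t1 t2 i j nk cphi (Lfun_measurable L1).
have [_] := independent_rv_mean ind' (Lfun2_Lfun1 (V2 n t1 i)) L1'.
rewrite mean_V mul0r => <-; apply: meanE => w.
by rewrite /term /phi; ring.
Qed.

(** The weights cover partial sums, with weight 1, and increments, with the indicator of
    [M <= n]. *)
Lemma term_sum_inner N (a b : nat -> R) x y t1 t2 i j : sphere d x -> sphere d y ->
  mean (fun w => (\sum_(n < N) a n * term n x t1 i w) *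
                 (\sum_(n < N) b n * term n y t2 j w)) =
  \sum_(n < N) a n * b n * ((G n).[dotv x y] * B n (t1 - t2) i j).
Proof.
move=> Sx Sy.
have L1 n k : (fun w => (a n * b k) * (term n x t1 i w * term k y t2 j w)) \in Lfun P 1.
  by apply: (@LfunZ _ _ _ _ _ _ 1) => //; apply: Lfun2M; exact: term_Lfun2.
transitivity (mean (fun w => \sum_(n < N) \sum_(k < N)
    (a n * b k) * (term n x t1 i w * term k y t2 j w))).
  apply: meanE => w; rewrite mulr_suml; apply: eq_bigr => n _.
  by rewrite mulr_sumr; apply: eq_bigr => k _; ring.
rewrite mean_lsum => [|n]; last by apply: (@Lfun_lsum _ _ _ _ 1).
apply: eq_bigr => n _; rewrite mean_lsum// (bigD1 n)//= big1 ?addr0 => [|k kn].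
  by rewrite meanZ ?term_inner// Lfun2M ?term_Lfun2.
by rewrite meanZ ?term_inner_neq ?mulr0 1?eq_sym// Lfun2M ?term_Lfun2.
Qed.

End FieldTerms.

(** * Mean square convergence of random vectors, entry by entry *)

Lemma cvg_sum0 (R : realType) (I : Type) (F : set_system I) {FF : Filter F} m
    (f : 'I_m -> I -> R) : (forall i, f i @ F --> 0) ->
  (fun x => \sum_i f i x) @ F --> 0.
Proof.
elim: m f => [|m IH] f f0.
  by under eq_fun do rewrite big_ord0; exact: cvg_cst.
under eq_fun do rewrite big_ord_recl.
have := cvgD (f0 ord0) (IH (fun i => f (lift ord0 i)) (fun i => f0 _)).
by rewrite addr0; apply.
Qed.

Section MeanSquareVectors.
Context {R : realType} {disp : measure_display} {Omega : measurableType disp}.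
Variables (P : probability Omega R) (m : nat).
Implicit Types X Y : Omega -> 'cV[R]_m.

Local Notation mean := (mean P).

Lemma mean_square_distE X Y : second_order P X -> second_order P Y ->
  mean_square_dist P X Y =
  (\sum_i mean (fun w => (entry X i w - entry Y i w) ^+ 2))%:E.
Proof.
move=> X2 Y2; rewrite -mean_lsum => [|i]; last exact: Lfun2_sqr (Lfun2B (X2 i) (Y2 i)).
rewrite meanK; last first.
  by apply: (@Lfun_lsum _ _ _ _ 1) => // i; exact: Lfun2_sqr (Lfun2B (X2 i) (Y2 i)).
congr (expectation _ _); apply/funext => w.
rewrite /enorm sqr_sqrtr ?dotvv_ge0// dotvE; apply: eq_bigr => i _.
by rewrite !mxE -expr2.
Qed.

Lemma cvg_mean_square_dist (X : nat -> Omega -> 'cV[R]_m) Y :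
  (forall n, second_order P (X n)) -> second_order P Y ->
  mean_square_dist P (X n) Y @[n --> \oo] --> 0%E <->
  forall i, ms_cvg P (fun n => entry (X n) i) (entry Y i).
Proof.
move=> X2 Y2; pose s n i := mean (fun w => (entry (X n) i w - entry Y i w) ^+ 2).
have s0 n i : 0 <= s n i by apply: mean_ge0 => w; exact: sqr_ge0.
have E : (fun n => mean_square_dist P (X n) Y) = (fun n => (\sum_i s n i)%:E).
  by apply/funext => n; exact: mean_square_distE.
rewrite E; split=> [/fine_cvgP[_ c] i|c].
  apply: (@squeeze_cvgr _ _ _ _ (cst 0) (fun n => \sum_i s n i)) => //; last exact: cvg_cst.
  apply: nearW => n; rewrite s0/= (bigD1 i)//= lerDl sumr_ge0//.
apply: cvg_EFin; first exact: nearW.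
exact: (@cvg_sum0 R nat _ _ m (fun i n => s n i)).
Qed.

End MeanSquareVectors.

Section DominatedSeries.
Context {R : realType}.

(** The Weierstrass M-test relative to [D]: two uniformly small tails and one continuous partial
    sum, a third of [e] each. *)
Lemma continuous_poly_series (a : nat -> {poly R}) (b : nat -> R) (D : set R) (c : R) :
  (forall n x, D x -> `|(a n).[x]| <= b n) -> cvgn (series b) -> D c ->
  forall e, 0 < e -> \forall x \near c, D x ->
    `|limn (series (fun n => (a n).[c])) - limn (series (fun n => (a n).[x]))| < e.
Proof.
move=> ab cb Dc e e0.
pose S N x := series (fun n => (a n).[x]) N.
have cS x : D x -> cvgn (S ^~ x).
  move=> Dx; apply: normed_cvg; apply: (series_le_cvg _ _ _ cb) => n //=.
  - by rewrite (le_trans _ (ab n x Dx)).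
  - exact: ab.
have [N HN] : exists N, limn (series b) - series b N < e / 3.
  have : \forall N \near \oo, `|limn (series b) - series b N| < e / 3.
    have cb' : series b @ \oo --> limn (series b) := cb.
    by move/cvgrPdist_lt : cb'; apply; rewrite divr_gt0.
  by move=> [N _ HN]; exists N; rewrite (le_lt_trans (ler_norm _))// HN//=.
have tail x : D x -> `|limn (S ^~ x) - S N x| < e / 3.
  move=> Dx; apply: le_lt_trans HN.
  have cn : `|S M x - S N x| @[M --> \oo] --> `|limn (S ^~ x) - S N x|.
    by apply: cvg_norm; apply: cvgB; [exact: cS|exact: cvg_cst].
  have cbN : series b M - series b N @[M --> \oo] --> limn (series b) - series b N.
    by apply: cvgB; [exact: cb|exact: cvg_cst].
  rewrite -(cvg_lim (@Rhausdorff _) cn) -(cvg_lim (@Rhausdorff _) cbN).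
  apply: ler_lim; [exact: cvgP cn|exact: cvgP cbN|].
  exists N => // M /= NM; rewrite !sub_series_geq//.
  by rewrite (le_trans (ler_norm_sum _ _ _))// ler_sum// => i _; exact: ab.
have cont : continuous (fun x => S N x).
  rewrite (_ : (fun x => S N x) = horner (\sum_(0 <= n < N) a n)).
    exact: continuous_horner.
  by apply/funext => x; rewrite horner_sum.
have : \forall x \near c, `|S N c - S N x| < e / 3.
  by have /cvgrPdist_lt := cont c; apply; rewrite divr_gt0.
apply: filterS => x Sx Dx.
have t1 := tail c Dc; have t2 := tail x Dx.
have -> : limn (S ^~ c) - limn (S ^~ x) =
  (limn (S ^~ c) - S N c) + (S N c - S N x) - (limn (S ^~ x) - S N x) by ring.
rewrite (le_lt_trans (ler_normB _ _))//.
have := ler_normD (limn (S ^~ c) - S N c) (S N c - S N x).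
lra.
Qed.

End DominatedSeries.

Section SpherePairs.
Context {R : realType} {d : nat}.

Lemma dotvv_sphere (x : 'cV[R]_d.+1) : dotv x x = 1 -> sphere d x.
Proof. by move=> xx; rewrite /sphere/= /enorm xx sqrtr1. Qed.

Lemma sphere_dotv_le1 (x y : 'cV[R]_d.+1) : sphere d x -> sphere d y ->
  `|dotv x y| <= 1.
Proof.
move=> /sphere_dotvv xx /sphere_dotvv yy.
have := dotv_cauchy_schwarz x y; rewrite xx yy mulr1 => H.
by rewrite -sqrtr1 -sqrtr_sqr ler_wsqrtr.
Qed.

(** Transfers what is known about means at points of the sphere to every argument in [[-1, 1]]. As
    [d > 0], the first and the last coordinate axes differ. *)
Lemma sphere_pair (c : R) : (0 < d)%N -> `|c| <= 1 ->
  exists x y : 'cV[R]_d.+1, [/\ sphere d x, sphere d y & dotv x y = c].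
Proof.
move=> d0 c1; pose e0 : 'cV[R]_d.+1 := delta_mx ord0 0.
pose e1 : 'cV[R]_d.+1 := delta_mx ord_max 0.
have e00 : dotv e0 e0 = 1 by rewrite dotv_delta mxE !eqxx.
have e11 : dotv e1 e1 = 1 by rewrite dotv_delta mxE !eqxx.
have e01 : dotv e0 e1 = 0.
  by rewrite dotv_delta mxE -val_eqE/= eq_sym (gtn_eqF d0).
have e10 : dotv e1 e0 = 0 by rewrite dotvC.
have s0 : 0 <= 1 - c ^+ 2 by rewrite subr_ge0 -real_normK ?num_real// expr_le1.
exists e0, (c *: e0 + Num.sqrt (1 - c ^+ 2) *: e1); split.
- exact: dotvv_sphere.
- apply: dotvv_sphere; rewrite !(dotvDl, dotvDr, dotvZl, dotvZr) e00 e11 e01 e10.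
  have := sqr_sqrtr s0; rewrite !expr2; lra.
- by rewrite dotvDr !dotvZr e00 e01 mulr0 addr0 mulr1.
Qed.

End SpherePairs.

(** * The random field *)

Section SeriesField.
Context {R : realType} {disp : measure_display} {Omega : measurableType disp}.
Variables (P : probability Omega R) (T : zmodType) (m d : nat).
Variables (G : nat -> {poly R}) (B : nat -> T -> 'M[R]_m).
Variables (V : nat -> T -> Omega -> 'cV[R]_m) (U : Omega -> 'cV[R]_d.+1).
Hypothesis d_ge2 : (2 <= d)%N.
Hypothesis GG : is_gegenbauer ((d%:R - 1) / 2) G.
Hypothesis V2 : forall n t, second_order P (V n t).
Hypothesis V_mean : forall n t, meanv P (V n t) = 0.
Hypothesis V_cov : forall n t1 t2,
  covmx P (V n t1) (V n t2) = (alpha d n) ^+ 2 *: B n (t1 - t2).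
Hypothesis unifU : uniform_on_sphere P U.
Hypothesis indUV : independent_vector_processes P U V.
Hypothesis B_cvg : cvg_mxseries (fun n => (G n).[1] *: B n 0).

Local Notation mean := (mean P).
Local Notation L2 := (Lfun P 2%:E).
Local Notation term := (term G V U).
Implicit Types (x y : 'cV[R]_d.+1) (t : T) (i j : 'I_m).

Let psum x t N w : 'cV[R]_m := \sum_(n < N) (G n).[dotv x (U w)] *: V n t w.

Let term2 n x t i : term n x t i \in L2.
Proof. exact: term_Lfun2 V2 V_mean V_cov unifU indUV n x t i. Qed.

Let psumE x t N i w : entry (psum x t N) i w = \sum_(n < N) term n x t i w.
Proof. by rewrite /entry /psum summxE; apply: eq_bigr => n _; rewrite mxE. Qed.

Let psum2 x t N i : entry (psum x t N) i \in L2.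
Proof.
have -> : entry (psum x t N) i = (fun w => \sum_(n < N) term n x t i w).
  by apply/funext => w; exact: psumE.
by apply: Lfun_lsum; rewrite ?ler1n.
Qed.

Let psum_mean x t N i : mean (entry (psum x t N) i) = 0.
Proof.
rewrite (meanE _ (psumE x t N i)) mean_lsum => [|n]; last exact: Lfun2_Lfun1.
by rewrite big1// => n _; exact: term_mean V2 V_mean unifU indUV n x t i.
Qed.

Let inner_sum N a b x y t1 t2 i j (Sx : sphere d x) (Sy : sphere d y) :=
  term_sum_inner d_ge2 GG V2 V_mean V_cov unifU indUV N a b t1 t2 i j Sx Sy.

Let psum_inner x y t1 t2 i j N : sphere d x -> sphere d y ->
  mean (fun w => entry (psum x t1 N) i w * entry (psum y t2 N) j w) =
  series (fun n => ((G n).[dotv x y] *: B n (t1 - t2)) i j) N.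
Proof.
move=> Sx Sy; rewrite /series/= big_mkord.
have := inner_sum N (fun=> 1) (fun=> 1) t1 t2 i j Sx Sy.
rewrite (meanE _ (Y := fun w => entry (psum x t1 N) i w * entry (psum y t2 N) j w)).
  by move=> ->; apply: eq_bigr => n _; rewrite mxE !mul1r.
by move=> w; rewrite !psumE; congr (_ * _); apply: eq_bigr => n _; rewrite mul1r.
Qed.

(** The mean square of an increment of partial sums is an increment of the series of
    [a n = G_n(1) B_n(0)_ii], which converges and has nonnegative terms because [a n] is the second
    moment of a term. *)
Let psum_cauchy x t i : sphere d x -> ms_cauchy P (fun N => entry (psum x t N) i).
Proof.
move=> Sx e e0.
pose a n := ((G n).[1] *: B n 0) i i.
have a0 n : 0 <= a n.
  have := term_inner d_ge2 GG V2 V_mean V_cov unifU indUV n t t i i Sx Sx.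
  rewrite (sphere_dotvv Sx) subrr /a mxE => <-.
  by apply: mean_ge0 => w; rewrite -expr2 sqr_ge0.
have diff M N : (M <= N)%N ->
    mean (fun w => (entry (psum x t N) i w - entry (psum x t M) i w) ^+ 2) =
    series a N - series a M.
  move=> MN; have E w : \sum_(n < N) (M <= n)%:R * term n x t i w =
      entry (psum x t N) i w - entry (psum x t M) i w.
    rewrite !psumE -!(big_mkord xpredT (fun n => term n x t i w)).
    rewrite (big_cat_nat _ MN)//= addrAC subrr add0r -(big_mkord xpredT
       (fun n => (M <= n)%:R * term n x t i w)) (big_cat_nat _ MN)//=.
    rewrite big_nat_cond big1 ?add0r => [|n /andP[/andP[_ nM] _]]; last first.
      by rewrite leqNgt nM mul0r.
    by apply: eq_big_nat => n /andP[-> _]; rewrite mul1r.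
  have := inner_sum N (fun n => (M <= n)%:R) (fun n => (M <= n)%:R) t t i i Sx Sx.
  rewrite (meanE _ (Y := fun w => (entry (psum x t N) i w - entry (psum x t M) i w) ^+ 2)).
    move=> ->; rewrite sub_series_geq// (sphere_dotvv Sx) subrr.
    rewrite -(big_mkord xpredT (fun n => (M <= n)%:R * (M <= n)%:R * ((G n).[1] * B n 0 i i))).
    rewrite (big_cat_nat _ MN)//= big_nat_cond big1 ?add0r => [|n /andP[/andP[_ nM] _]].
      by apply: eq_big_nat => n /andP[-> _]; rewrite /a mxE !mul1r.
    by rewrite leqNgt nM !mul0r.
  by move=> w; rewrite E expr2.
have ca : cvgn (series a) by exact: B_cvg.
have nda : nondecreasing_seq (series a) by apply: nondecreasing_series => n _ _; exact: a0.
have [N HN] : exists N, limn (series a) - series a N < e.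
  have ca' : series a @ \oo --> limn (series a) := ca.
  move/cvgrPdist_lt : ca' => /(_ e e0)[N _ HN].
  by exists N; rewrite (le_lt_trans (ler_norm _))// HN//=.
have le n k : (N <= n)%N -> (n <= k)%N -> series a k - series a n <= e.
  move=> Nn nk; apply: ltW; apply: le_lt_trans HN; apply: lerB.
    exact: nondecreasing_cvgn_le.
  exact: nda.
exists N => n k Nn Nk; have [nk|/ltnW kn] := leqP n k; last first.
  by rewrite diff// le.
rewrite (meanE _ (Y := fun w => (entry (psum x t k) i w - entry (psum x t n) i w) ^+ 2)).
  by rewrite diff// le.
by move=> w; ring.
Qed.

Lemma series_field_exists : exists Z, is_series_field P G U V Z.
Proof.
(* The sphere hypothesis sits below the existential so that choice yields a function of all [x]. *)
have S x t i : exists S, sphere d x ->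
    S \in L2 /\ ms_cvg P (fun N => entry (psum x t N) i) S.
  have [Sx|nSx] := pselect (sphere d x); last by exists (cst 0).
  have [S S2 cS] := ms_complete (fun N => psum2 x t N i) (psum_cauchy t i Sx).
  by exists S.
pose F x t i := projT1 (cid (S x t i)).
have FP x t i : sphere d x ->
    F x t i \in L2 /\ ms_cvg P (fun N => entry (psum x t N) i) (F x t i).
  by rewrite /F; case: cid.
exists (fun x t w => \col_i F x t i w) => x t Sx.
have eF i : entry (fun w => \col_i F x t i w) i = F x t i.
  by apply/funext => w; rewrite /entry mxE.
have Z2 : second_order P (fun w => \col_i F x t i w).
  by move=> i; rewrite eF; exact: (FP x t i Sx).1.
split=> //; apply/cvg_mean_square_dist => // [N|] i; first exact: psum2.
by rewrite eF; exact: (FP x t i Sx).2.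
Qed.

Variable Z : 'cV[R]_d.+1 -> T -> Omega -> 'cV[R]_m.
Hypothesis ZE : is_series_field P G U V Z.

Lemma series_field_second_order x t : sphere d x -> second_order P (Z x t).
Proof. by move=> Sx; case: (ZE t Sx). Qed.

Let Z_ms x t i : sphere d x -> ms_cvg P (fun N => entry (psum x t N) i) (entry (Z x t) i).
Proof.
move=> Sx; have [Z2 cZ] := ZE t Sx.
exact: (cvg_mean_square_dist (psum2 x t) Z2).1 cZ i.
Qed.

Lemma series_field_mean_entry x t i : sphere d x -> mean (entry (Z x t) i) = 0.
Proof.
move=> Sx; have Z2 := series_field_second_order t Sx i.
have := ms_cvg_mean (fun N => psum2 x t N i) Z2 (Z_ms t i Sx).
under eq_fun do rewrite psum_mean.
move=> /(cvg_lim (@Rhausdorff _)) <-; exact: lim_cst.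
Qed.

Lemma series_field_mean x t : sphere d x -> meanv P (Z x t) = 0.
Proof.
move=> Sx; apply/matrixP => i j; rewrite !mxE.
exact: series_field_mean_entry.
Qed.

(** Convergence of the covariance series, at every lag and for off-diagonal entries too, is part of
    the conclusion: its partial sums are inner products of sequences converging in mean square. *)
Lemma series_field_inner x y t1 t2 i j : sphere d x -> sphere d y ->
  series (fun n => ((G n).[dotv x y] *: B n (t1 - t2)) i j) @ \oo -->
  mean (fun w => entry (Z x t1) i w * entry (Z y t2) j w).
Proof.
move=> Sx Sy.
have := ms_cvg_inner (fun N => psum2 x t1 N i) (fun N => psum2 y t2 N j)
  (series_field_second_order t1 Sx i) (series_field_second_order t2 Sy j)
  (Z_ms t1 i Sx) (Z_ms t2 j Sy).
by under eq_fun do rewrite psum_inner//.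
Qed.

(** [limn] is total; that these series converge is the content of [field_cov_series]. *)
Definition field_cov (theta : R) t : 'M[R]_m :=
  \matrix_(i, j) limn (series (fun n => ((G n).[cos theta] *: B n t) i j)).

Lemma series_field_cov : has_covariance_function P Z field_cov.
Proof.
move=> x y t1 t2 Sx Sy; apply/matrixP => i j; rewrite !mxE.
rewrite covarianceEmean; [|exact: series_field_second_order..].
rewrite !series_field_mean_entry// mulr0 subr0.
have -> : cos (sdist x y) = dotv x y.
  by rewrite acosK// in_itv/= -ler_norml sphere_dotv_le1.
by rewrite (cvg_lim (@Rhausdorff _) (@series_field_inner x y t1 t2 i j Sx Sy)).
Qed.

(** The series is realised as a covariance of the field: two points with inner product [cos theta],
    at times [t] and 0. *)
Lemma field_cov_series theta t : mxseries_to (fun n => (G n).[cos theta] *: B n t)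
  (field_cov theta t).
Proof.
move=> i j; rewrite mxE.
have c1 : `|cos theta| <= 1 by rewrite ler_norml cos_geN1 cos_le1.
have [x [y [Sx Sy xy]]] := sphere_pair (ltnW d_ge2) c1.
have := @series_field_inner x y t 0 i j Sx Sy; rewrite xy subr0.
by move=> c; apply: cvgP c.
Qed.

(** With [L i] the [i]-th diagonal entry of the covariance at lag 0 as a function of the inner
    product, the squared distance is the sum of [2 (L i 1 - L i (x'x0))], so continuity of each
    [L i] at 1 within [[-1, 1]] is enough. *)
Lemma series_field_continuous : mean_square_continuous P Z.
Proof.
move=> t x0 Sx0.
pose b i n := ((G n).[1] *: B n 0) i i.
pose a i n : {poly R} := (B n 0 i i)%:P * G n.
pose L i c := limn (series (fun n => (a i n).[c])).
have aE i n c : (a i n).[c] = ((G n).[c] *: B n 0) i i.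
  by rewrite /a hornerM hornerC mxE mulrC.
have innerE x y i : sphere d x -> sphere d y ->
    mean (fun w => entry (Z x t) i w * entry (Z y t) i w) = L i (dotv x y).
  move=> Sx Sy; rewrite /L; under [in RHS]eq_fun do rewrite aE.
  rewrite -(subrr t); apply/esym; apply: (cvg_lim (@Rhausdorff _)).
  exact: series_field_inner.
(* The bound by the value at 1 is Cauchy-Schwarz for the [n]-th terms of the field at two points
   with inner product [c]. *)
have ab i n c : `|c| <= 1 -> `|(a i n).[c]| <= b i n.
  move=> c1; have [x [y [Sx Sy xy]]] := sphere_pair (ltnW d_ge2) c1.
  have I u v (Su : sphere d u) (Sv : sphere d v) :=
    term_inner d_ge2 GG V2 V_mean V_cov unifU indUV n t t i i Su Sv.
  have E : (a i n).[c] = mean (fun w => term n x t i w * term n y t i w).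
    by rewrite I// xy subrr aE mxE.
  have bE u : sphere d u -> mean (fun w => term n u t i w ^+ 2) = b i n.
    move=> Su; rewrite /b mxE -(subrr t) -[1 in RHS](sphere_dotvv Su) -I//.
  have b0 : 0 <= b i n by rewrite -(bE x Sx); apply: mean_ge0 => w; exact: sqr_ge0.
  rewrite E (le_trans (mean_cauchy_schwarz (term2 n x t i) (term2 n y t i)))//.
  by rewrite !bE// -expr2 sqr_sqrtr.
have Lc i e : 0 < e -> \forall c \near (1 : R), `|c| <= 1 -> `|L i 1 - L i c| < e.
  move=> e0; apply: (continuous_poly_series (D := [set c | `|c| <= 1]) (b := b i)) => //=.
    by move=> n c; exact: ab.
  - exact: B_cvg.
  - by rewrite normr1.
pose h i x := 2 * (L i 1 - L i (dotv x x0)).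
have distE x : sphere d x -> mean_square_dist P (Z x t) (Z x0 t) = (\sum_i h i x)%:E.
  move=> Sx; have Zx := series_field_second_order t Sx.
  have Zx0 := series_field_second_order t Sx0.
  rewrite mean_square_distE//; congr EFin; apply: eq_bigr => i _.
  rewrite mean_sqrB// innerE//.
  have sq u : sphere d u -> mean (fun w => entry (Z u t) i w ^+ 2) = L i 1.
    by move=> Su; rewrite -[1](sphere_dotvv Su) -innerE.
  by rewrite !sq// /h; ring.
have hc : (fun x => \sum_i h i x) @ within (sphere d) (nbhs x0) --> 0.
  apply: cvg_sum0 => i; apply/cvgr0Pnorm_lt => e e0.
  have e2 : 0 < e / 2 by rewrite divr_gt0.
  have cdot : (fun x => dotv x x0) @ x0 --> (1 : R).
    rewrite -(sphere_dotvv Sx0) (_ : (fun x => dotv x x0) = dotv x0).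
      exact: continuous_dotv.
    by apply/funext => x; rewrite dotvC.
  have H : \forall x \near x0, `|dotv x x0| <= 1 -> `|L i 1 - L i (dotv x x0)| < e / 2.
    exact: cdot _ (Lc i _ e2).
  rewrite near_withinE; near=> x => Sx.
  have Hx : `|dotv x x0| <= 1 -> `|L i 1 - L i (dotv x x0)| < e / 2 by near: x.
  have := Hx (sphere_dotv_le1 Sx Sx0).
  by rewrite ltr_pdivlMr// => Lx; rewrite /h normrM ger0_norm// mulrC.
have hE : (fun x => (\sum_i h i x)%:E) @ within (sphere d) (nbhs x0) --> 0%E.
  by apply: cvg_EFin hc; exact: nearW.
apply: cvg_trans hE; apply: near_eq_cvg; rewrite near_withinE.
by apply: nearW => x Sx; rewrite distE.
Unshelve. all: by end_near. Qed.

End SeriesField.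

(** A mean square sum is determined only up to null events, separately for each point and time;
    hence the existence of a field, followed by the properties of every such field. *)
Theorem theorem4 (R : realType) (m d : nat) (k : time_kind)
    (disp : measure_display) (Omega : measurableType disp)
    (P : probability Omega R)
    (G : nat -> {poly R})
    (B : nat -> time_group R k -> 'M[R]_m)
    (V : nat -> time_group R k -> Omega -> 'cV[R]_m)
    (U : Omega -> 'cV[R]_d.+1)
    (m_gt0 : (0 < m)%N)
    (d_ge2 : (2 <= d)%N)
    (G_gegenbauer : is_gegenbauer ((d%:R - 1) / 2) G)
    (V_stationary : forall n, stationary P (V n))
    (V_mean : forall n t, meanv P (V n t) = 0)
    (V_cov : forall n t1 t2,
      covmx P (V n t1) (V n t2) = (alpha d n) ^+ 2 *: B n (t1 - t2))
    (U_uniform : uniform_on_sphere P U)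
    (UV_independent : independent_vector_processes P U V)
    (B_cvg : cvg_mxseries (fun n => (G n).[1] *: B n 0)) :
  (exists Z, is_series_field P G U V Z) /\
  forall Z : 'cV[R]_d.+1 -> time_group R k -> Omega -> 'cV[R]_m,
    is_series_field P G U V Z ->
    [/\ isotropic_stationary P Z,
        mean_square_continuous P Z,
        (forall x t, sphere d x -> meanv P (Z x t) = 0) &
        exists C : R -> time_group R k -> 'M[R]_m,
          has_covariance_function P Z C /\
          forall theta t, 0 <= theta <= pi ->
            mxseries_to (fun n => (G n).[cos theta] *: B n t) (C theta t)].
Proof.
have V2 n t : second_order P (V n t) by have [V2 _ _] := V_stationary n.
split; first exact: (series_field_exists d_ge2 G_gegenbauer V2 V_mean V_cov U_uniform
  UV_independent B_cvg).
move=> Z ZE.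
have mean0 x t : sphere d x -> meanv P (Z x t) = 0.
  exact: (series_field_mean V2 V_mean V_cov U_uniform UV_independent ZE).
have covZ := series_field_cov d_ge2 G_gegenbauer V2 V_mean V_cov U_uniform
  UV_independent ZE.
split=> //.
- split; last by exists (field_cov G B).
    by move=> x t; exact: series_field_second_order ZE x t.
  by exists 0.
- exact: (series_field_continuous d_ge2 G_gegenbauer V2 V_mean V_cov U_uniform
    UV_independent B_cvg ZE).
- exists (field_cov G B); split=> // theta t _.
  exact: (field_cov_series d_ge2 G_gegenbauer V2 V_mean V_cov U_uniform
    UV_independent ZE).
Qed.
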